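(* There exists an integer $\Delta_0 \geq 0$ such that every graph $G$ with maximum degree $\Delta \geq \Delta_0$ and no isolated edge has an adjacent vertex distinguishing edge colouring with at most $\Delta+19$ colours.
   Context: Graphs are finite, undirected, loopless and without parallel edges. An isolated edge of $G$ is an edge $uv$ such that both $u$ and $v$ have degree $1$ in $G$. A (edge) colouring of $G$ is a map $c:E(G)\to\mathbb{N}$; it is proper if any two edges sharing an endpoint receive distinct colours. For a proper colouring $c$ and a vertex $u$, $S_c(u)$ denotes the set of colours appearing on edges incident to $u$. A proper colouring $c$ is adjacent vertex distinguishing if $S_c(u)\neq S_c(v)$ for every edge $uv\in E(G)$. *)

(* Defs.v *)
From mathcomp Require Import all_boot finmap.

Set Implicit Arguments.
Unset Strict Implicit.
Unset Printing Implicit Defensive.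

Local Open Scope fset_scope.

Record sgraph := SGraph {
  vertex :> finType;
  adj : rel vertex;
  adj_sym : symmetric adj;
  adj_irrefl : irreflexive adj
}.

Section Graph.

Variable G : sgraph.

(* An edge is the 2-element set of its endpoints. *)
Definition edges : {set {set G}} :=
  [set [set p.1; p.2] | p : G * G & adj p.1 p.2].

Definition edge := {f : {set G} | f \in edges}.

Definition degree (u : G) : nat := #|[set v | adj u v]|.

Definition max_degree : nat := \max_(u : G) degree u.

Definition isolated_edge (u v : G) : bool :=
  [&& adj u v, degree u == 1 & degree v == 1].

Definition colouring := edge -> nat.

Definition proper (c : colouring) : Prop :=
  forall (f g : edge) (u : G),
    f != g -> u \in val f -> u \in val g -> c f != c g.

(* S_c(u) *)
Definition palette (c : colouring) (u : G) : {fset nat} :=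
  [fset c f | f : edge & u \in val f].

Definition adjacent_vertex_distinguishing (c : colouring) : Prop :=
  proper c /\ forall u v : G, adj u v -> palette c u != palette c v.

Definition nb_colours (c : colouring) : nat := #|` [fset c f | f : edge]|.

End Graph.

(* Main.v *)
Require Import Defs.
From Stdlib Require Import Classical.
From mathcomp Require Import all_boot finmap fingroup perm zify.

Set Implicit Arguments.
Unset Strict Implicit.
Unset Printing Implicit Defensive.

(* Write D for the maximum degree. Call a vertex high if its degree is at least about 0.44 D, and
   low otherwise. In the graph of low-low edges, merge the two ends of every isolated edge; the
   edges with a high end then form a multigraph H, whose parallel edges all lead to merged
   vertices. Vizing's fan argument, rooted at high vertices, colours H with D + 1 colours.

   Every high vertex picks two of its edges in H, and the set F of picked edges receives 18 new
   colours, again by Vizing. This needs that at most 15 edges at a vertex are picked from their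
   other ends, which bounds the degrees in F by 17 (by 15 at low vertices);
   and it distinguishes adjacent high vertices u, v as soon as the old colours that remain at u
   and at v differ. Good picks exist by counting: going through the 2 picks of every high vertex
   one by one, each step multiplies the number of valid partial choices by at least B, about D / 5.
   Indeed a step has about 1.1 B outcomes; those overloading a vertex are fewer than 1.1 B (5.1)^15
   / 15! < 0.04 B times the number of valid choices, because forgetting 15 earlier picks divides
   that number by B^15, and those spoiling a high-high edge only cost a constant.

   The low-low edges are coloured last, again by counting: each has about 0.12 D admissible colours,
   and a pair of low neighbours is spoiled by few of them, since two undetermined edges at the same
   vertex can complete its palette to a given one in only two ways. The only low pairs that cannot
   be treated in this way are the merged ones, whose palettes in H are disjoint and nonempty. *)

(** * Edge colouring of multigraphs *)

Section Multigraph.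

Variables (E V : finType) (ends : E -> {set V}).

Definition edges_at (D : {set E}) (v : V) : {set E} := [set e in D | v \in ends e].

Lemma in_edges_at (v : V) e : (e \in edges_at [set: E] v) = (v \in ends e).
Proof. by rewrite !inE. Qed.

Definition loopless (D : {set E}) := {in D, forall e, #|ends e| = 2}.

Definition proper_on (C : eqType) (D : {set E}) (c : E -> C) :=
  forall e f v, e \in edges_at D v -> f \in edges_at D v -> c e = c f -> e = f.

(** The far end of [e] seen from [v]; the default is returned only when [e] has no end besides
    [v]. *)
Definition other (v : V) (e : E) : V := odflt v [pick w in ends e :\ v].

Lemma endsE D v e : loopless D -> e \in edges_at D v ->
  ends e = [set v; other v e] /\ other v e != v.
Proof.
move=> D2; rewrite inE => /andP[eD ve]; have := cardsD1 v (ends e).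
rewrite D2 // ve => /eqP; rewrite eqSS eq_sym => /cards1P[w ew].
rewrite /other ew; case: pickP => [w' | /(_ w)]; rewrite ?inE ?eqxx //= => /eqP->.
have := set11 w; rewrite -ew !inE => /andP[wv _]; split=> //.
by rewrite setD1K.
Qed.

Lemma edges_at_other D v e : loopless D -> e \in edges_at D v -> e \in edges_at D (other v e).
Proof.
move=> D2 ev; have [ee _] := endsE D2 ev; move: ev; rewrite !inE => /andP[-> _].
by rewrite ee !inE eqxx orbT.
Qed.

Lemma other_uniq D v w e : loopless D -> e \in edges_at D v -> e \in edges_at D w ->
  w != v -> w = other v e.
Proof.
move=> D2 ev; have [ee _] := endsE D2 ev; rewrite inE ee !inE => /andP[_].
by case/orP=> [/eqP->|/eqP//]; rewrite eqxx.
Qed.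

Lemma otherK D v e : loopless D -> e \in edges_at D v -> other (other v e) e = v.
Proof.
move=> D2 ev; have [_ nv] := endsE D2 ev.
by rewrite -(other_uniq D2 (edges_at_other D2 ev) ev) // eq_sym.
Qed.

(** * Kempe chains *)

Section Kempe.

Variables (C : eqType) (D : {set E}) (c : E -> C).
Hypotheses (D2 : loopless D) (cP : proper_on D c).

(** The matching formed by the edges of colour [a], made total by fixing every vertex that misses
    [a]; for a proper colouring this is an involution. *)
Definition cross (a : C) (v : V) : V :=
  if [pick e in edges_at D v | c e == a] is Some e then other v e else v.

Lemma cross_edge v e : e \in edges_at D v -> cross (c e) v = other v e.
Proof.
move=> ev; rewrite /cross; case: pickP => [f /andP[fv /eqP cf]|/(_ e)].
  by rewrite (cP fv ev cf).
by rewrite ev eqxx.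
Qed.

Lemma cross_id a v : (forall e, e \in edges_at D v -> c e != a) -> cross a v = v.
Proof.
move=> va; rewrite /cross; case: pickP => // f /andP[fv /eqP cf].
by have /eqP := va _ fv.
Qed.

Lemma crossK a : involutive (cross a).
Proof.
move=> v; case: (boolP [exists e in edges_at D v, c e == a]).
  move=> /exists_inP[e ev /eqP <-]; rewrite (cross_edge ev).
  by rewrite (cross_edge (edges_at_other D2 ev)) (otherK D2 ev).
rewrite negb_exists_in => /forall_inP va.
by rewrite (cross_id va) (cross_id va).
Qed.

Variables (x : V) (a b : C).

(** The first step uses [b], because [a] will be assumed missing at [x]. *)
Fixpoint walk (t : nat) : V :=
  if t is t'.+1 then cross (if odd t' then a else b) (walk t') else x.

Definition kempe_rel : rel V := [rel v w | (cross a v == w) || (cross b v == w)].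

Definition kempe : {set V} := [set v | connect kempe_rel x v].

Lemma kempe_refl : x \in kempe.
Proof. by rewrite inE connect0. Qed.

Lemma kempe_closed v e : e \in edges_at D v -> v \in kempe -> (c e == a) || (c e == b) ->
  ends e \subset kempe.
Proof.
move=> ev vC ce; have [-> _] := endsE D2 ev.
apply/subsetP=> w; rewrite !inE => /orP[/eqP->|/eqP->]; first by rewrite inE in vC.
rewrite inE in vC; apply: connect_trans vC (connect1 _) => /=.
by apply/orP; case/orP: ce => /eqP ce; [left | right]; rewrite -ce (cross_edge ev).
Qed.

Hypothesis xa : forall e, e \in edges_at D x -> c e != a.

Lemma walk_back t : cross (if odd t then a else b) (walk t.+1) = walk t.
Proof. by rewrite /= crossK. Qed.

(* The alternating walk from the end [x] of a path turns back at a vertex [y] missing [b]. *)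
Lemma walk_covers i : (forall e, e \in edges_at D (walk i) -> c e != b) ->
    (forall j, walk j = walk i -> i <= j) ->
  forall v, v \in kempe -> exists2 t, t <= i & walk t = v.
Proof.
move=> yb imin v; rewrite inE => /connectP[p]; elim/last_ind: p v => [|p w IH] v /=.
  by move=> _ ->; exists 0.
rewrite rcons_path last_rcons => /andP[pp +] ->.
have [t ti <-] := IH _ pp erefl.
(* For odd [i] the last step is a [b]-step; as [walk i] misses [b], this step did not move, against
   the minimality of [i]. *)
have oddi : odd i = false.
  case: i yb imin {ti IH} => // i yb imin; apply/negbTE/negP => /= oi.
  have := walk_back i; rewrite (negbTE oi) cross_id // => /esym /imin.
  by rewrite ltnn.
have stay : cross b (walk i) = walk i by apply: cross_id.
have start : cross a (walk 0) = walk 0 by apply: cross_id.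
case/orP=> /eqP <-.
- case: t ti {IH} => [|t] ti; first by exists 0; rewrite ?start.
  have := walk_back t; case: ifP => ot wt; first by exists t => //; apply: ltnW.
  have {}ti : t.+1 < i.
    by rewrite ltn_neqAle ti andbT; apply: contraFneq oddi => <- /=; rewrite ot.
  by exists t.+2 => //=; rewrite ot.
- case: (eqVneq t i) => [->|nti]; first by exists i; rewrite ?stay.
  have {}ti : t < i by rewrite ltn_neqAle nti.
  case ot: (odd t); last by exists t.+1 => //=; rewrite ot.
  case: t ot ti {nti IH} => // t /= ot ti; exists t; first by lia.
  by rewrite (negbTE ot) crossK.
Qed.

(** The component is a path starting at [x], so only its last vertex can miss [b]. Of two such
    vertices let [y] be met first by the walk; the walk up to [y] covers the component, so [z] is
    met no later. *)
Lemma kempe_ends y z : (forall e, e \in edges_at D y -> c e != b) ->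
    (forall e, e \in edges_at D z -> c e != b) ->
  y \in kempe -> z \in kempe -> y = z.
Proof.
have reach v : v \in kempe -> exists i, walk i == v.
  rewrite inE => /connectP[p]; elim/last_ind: p v => [|p w IH] v /=.
    by move=> _ ->; exists 0.
  rewrite rcons_path last_rcons => /andP[pp +] ->.
  have [t /eqP <-] := IH _ pp erefl.
  case/orP=> /eqP <-; last first.
    case ot: (odd t); last by exists t.+1; rewrite /= ot.
    by case: t ot {IH} => // t /= ot; exists t; rewrite (negbTE ot) crossK.
  case ot: (odd t); first by exists t.+1; rewrite /= ot.
  case: t ot {IH} => [|t] /= ot; first by exists 0; rewrite cross_id.
  by exists t; rewrite (negbFE ot) crossK.
move=> yb zb yC zC; wlog: y z yb zb yC zC / ex_minn (reach y yC) <= ex_minn (reach z zC).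
  move=> H; have [/(H _ _ yb zb) //|/ltnW yz] := leqP (ex_minn (reach y yC)) (ex_minn (reach z zC)).
  by apply/esym; apply: H yz.
case: ex_minnP => i /eqP wi imin; case: ex_minnP => j /eqP wj jmin ij.
have [||t ti wt] := @walk_covers i _ _ z zC; first by rewrite wi.
  by move=> t /eqP; rewrite wi => /imin.
have jt : j <= t by apply: jmin; rewrite wt.
by rewrite -wi -wj; congr walk; lia.
Qed.

End Kempe.

(** * Vizing's fans in multigraphs *)

Section Fans.

Variable k : nat.

Definition missing (D : {set E}) (c : E -> 'I_k) (v : V) : {set 'I_k} :=
  [set a | [forall e in edges_at D v, c e != a]].

Lemma missingP D c v a :
  reflect (forall e, e \in edges_at D v -> c e != a) (a \in missing D c v).
Proof. by rewrite inE; apply: forall_inP. Qed.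

Lemma card_missing D c v : k <= #|missing D c v| + #|edges_at D v|.
Proof.
rewrite -[X in X <= _](card_ord k) -cardsT -(cardsID (missing D c v) setT) setTI leq_add2l.
apply: leq_trans (leq_imset_card c _); apply: subset_leq_card.
apply/subsetP => a; rewrite !inE andbT negb_forall_in => /exists_inP[e ev].
by rewrite negbK => /eqP <-; apply: imset_f.
Qed.

Lemma edges_at_sub (D D' : {set E}) v : D \subset D' -> edges_at D v \subset edges_at D' v.
Proof. by move=> /subsetP DD'; apply/subsetP=> e; rewrite !inE => /andP[/DD'-> ->]. Qed.

Definition recolour (c : E -> 'I_k) e0 a : E -> 'I_k := [eta c with e0 |-> a].

Lemma recolour_proper D e0 x c a : loopless (e0 |: D) -> e0 \notin D ->
  x \in ends e0 -> proper_on D c -> a \in missing D c x ->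
  a \in missing D c (other x e0) -> proper_on (e0 |: D) (recolour c e0 a).
Proof.
move=> D2 e0D xe0 cP /missingP ax /missingP ay.
have e0x : e0 \in edges_at (e0 |: D) x by rewrite !inE eqxx.
have away f v : e0 \in edges_at (e0 |: D) v -> f \in edges_at D v -> c f != a.
  move=> e0v; suff: v \in [set x; other x e0] by rewrite in_set2 => /orP[/eqP->|/eqP->]; [apply: ax | apply: ay].
  by rewrite -(endsE D2 e0x).1; move: e0v; rewrite inE => /andP[].
have inD f v : f != e0 -> f \in edges_at (e0 |: D) v -> f \in edges_at D v.
  by move=> /negbTE fe0; rewrite !inE fe0.
move=> e f v ev fv; rewrite /recolour /=; do 2 case: eqVneq => [?|?]; subst => //.
- by move=> /esym/eqP; rewrite (negbTE (away _ _ ev _)) ?inD.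
- by move=> /eqP; rewrite (negbTE (away _ _ fv _)) ?inD.
- by apply: (cP _ _ v); apply: inD.
Qed.

(** The paths of this relation from the uncoloured edge are the fans at [x]. Fans consist of edges
    rather than neighbours because edges may be parallel. *)
Definition fan_step (D : {set E}) c x : rel E :=
  [rel e f | (f \in edges_at D x) && (c f \in missing D c (other x e))].

(** Each edge of the fan takes the colour of its successor and the last one takes [a]. The induction
    gives [e0] the colour of [e1], which makes [e1] the uncoloured edge. *)
Lemma fan_shift D x p : loopless D -> forall c e0 a, e0 \in edges_at D x ->
  proper_on (D :\ e0) c -> path (fan_step (D :\ e0) c x) e0 p -> uniq (e0 :: p) ->
  a \in missing (D :\ e0) c x -> a \in missing (D :\ e0) c (other x (last e0 p)) ->
  exists c' : E -> 'I_k, proper_on D c'.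
Proof.
move=> D2; elim: p => [|e1 p IH] c e0 a e0x cP.
  move=> _ _ ax ay; have [e0D xe0] : e0 \in D /\ x \in ends e0 by apply/andP; rewrite inE in e0x.
  by exists (recolour c e0 a); rewrite -(setD1K e0D); apply: recolour_proper (ay); rewrite ?setD1K ?setD11.
rewrite [path _ _ _]/= -andbA => /and3P[e1x ce1 pp] /=; rewrite inE negb_or => /andP[/andP[e01 e0p] e1p] ax ay.
have [e0D xe0] : e0 \in D /\ x \in ends e0 by apply/andP; rewrite inE in e0x.
have e1x' : e1 \in edges_at D x by apply: subsetP e1x; apply/edges_at_sub/subsetDl.
have De1 : D :\ e1 = e0 |: (D :\ e0 :\ e1).
  by apply/setP=> e; rewrite !inE; case: (eqVneq e e0) => //= ->; rewrite e0D e01.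
have subM e v b : b \in missing (D :\ e0) c v -> b \in missing (D :\ e0 :\ e) c v.
  move=> /missingP bv; apply/missingP=> f fv; apply: bv.
  by apply: subsetP fv; apply/edges_at_sub/subsetDl.
(* The only colour that can stop being missing anywhere is the one moved to [e0]. *)
have updM v b : b != c e1 -> b \in missing (D :\ e0) c v ->
    b \in missing (D :\ e1) (recolour c e0 (c e1)) v.
  move=> be1 /missingP bv; apply/missingP=> f; rewrite /recolour /=.
  case: (eqVneq f e0) => [_ _|fe0] /=; first by rewrite eq_sym be1.
  by rewrite !inE => /andP[/andP[_ fD] fv]; apply: bv; rewrite !inE fe0 fD.
apply: (IH (recolour c e0 (c e1)) e1 a) => //.
- rewrite De1; apply: (@recolour_proper _ _ x) => //; rewrite -?De1.
  + by move=> e /setD1P[_] /D2.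
  + by rewrite !inE eqxx andbF.
  + move=> e f v ev fv; have sv := subsetP (edges_at_sub v (subsetDl (D :\ e0) [set e1])).
    by apply: (cP e f v); apply: sv.
  + apply/missingP=> f fx; apply/eqP => cf.
    have fx' : f \in edges_at (D :\ e0) x by apply: subsetP fx; apply/edges_at_sub/subsetDl.
    by move: fx; rewrite (cP _ _ _ fx' e1x cf) !inE eqxx.
  + exact: subM.
(* The path has to remember that its later edges lie in [p], hence differ from [e0] and [e1]. *)
- have {}pp : path (fun e f => fan_step (D :\ e0) c x e f && (f \in p)) e1 p.
    elim: (p) (e1) (pp) => //= f q IHq e /andP[-> /IHq{}IHq]; rewrite inE eqxx /=.
    by apply: sub_path IHq => g h /andP[-> hq]; rewrite inE hq orbT.
  apply: sub_path pp => e f /andP[/andP[fx cf] fp].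
  have fe1 : f != e1 by apply: contraTneq fp => ->; case/andP: e1p.
  have fe0 : f != e0 by apply: contraTneq fp => ->.
  apply/andP; split.
    by move: fx; rewrite !inE fe1 => /andP[/andP[_ ->] ->].
  rewrite {1}/recolour /= (negbTE fe0); apply: updM => //.
  by apply: contraNneq fe1 => /(cP _ _ x fx e1x) ->.
- apply: updM => //; apply/eqP => ae1; have /missingP/(_ e1) := ax.
  by rewrite ae1 eqxx => /(_ e1x).
- apply: updM => //; apply/eqP => ae1; have /missingP/(_ e1) := ax.
  by rewrite ae1 eqxx => /(_ e1x).
Qed.

Section KempeSwitch.

Variables (D : {set E}) (c : E -> 'I_k) (x : V) (a b : 'I_k).
Hypotheses (D2 : loopless D) (cP : proper_on D c).

(* Switching everywhere outside the component of [x] keeps the colours at [x]. *)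
Definition kempe_switch (e : E) : 'I_k :=
  if [disjoint ends e & kempe D c x a b] then tperm a b (c e) else c e.

(** If [v] is outside the component but [e] meets it, then [e] has neither of the colours [a], [b],
    and the transposition fixes its colour. *)
Lemma kempe_switchE v e : e \in edges_at D v ->
  kempe_switch e = if v \in kempe D c x a b then c e else tperm a b (c e).
Proof.
move=> ev; have ve : v \in ends e by move: ev; rewrite inE => /andP[].
rewrite /kempe_switch; case: ifPn => [/disjointFr -> // | meets].
case: ifPn => // vC; rewrite tpermD //; apply: contraNneq vC => ce.
  all: move: meets; rewrite -setI_eq0 => /set0Pn[w]; rewrite inE => /andP[we wC].
  all: have ew : e \in edges_at D w by move: ev; rewrite !inE we => /andP[->].
  all: by apply: subsetP ve; apply: (kempe_closed _ _ ew wC); rewrite // ce eqxx ?orbT.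
Qed.

Lemma kempe_switch_proper : proper_on D kempe_switch.
Proof.
move=> e f v ev fv; rewrite (kempe_switchE ev) (kempe_switchE fv); case: ifP => _.
  exact: cP ev fv.
by move/perm_inj; apply: cP ev fv.
Qed.

Lemma missing_switch v d : (d \in missing D kempe_switch v) =
  ((if v \in kempe D c x a b then d else tperm a b d) \in missing D c v).
Proof.
apply/missingP/missingP => dv e ev; have := dv e ev; rewrite (kempe_switchE ev).
  by case: ifP => // _; rewrite -{1}[d](tpermK a b) (inj_eq perm_inj).
by case: ifP => // _; rewrite -{2}[d](tpermK a b) (inj_eq perm_inj).
Qed.

End KempeSwitch.

(** Suppose that no extension exists. Then distinct far ends of reachable edges miss disjoint sets
    of colours, and each missing colour sits on a reachable coloured edge at [x]. So fewer colours
    are missing in total than there are reachable edges, whereas the bound on degree plus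
    multiplicity gives at least as many. *)
Lemma vizing_extend D e0 x (c : E -> 'I_k) : loopless D -> e0 \in edges_at D x ->
    proper_on (D :\ e0) c -> #|edges_at D x| <= k ->
    (forall y, y != x -> edges_at D x :&: edges_at D y != set0 ->
       #|edges_at D y| + #|edges_at D x :&: edges_at D y| <= k) ->
  exists c' : E -> 'I_k, proper_on D c'.
Proof.
move=> D2 e0x cP degx degy; apply: NNPP => nocol.
have D'2 : loopless (D :\ e0) by move=> e /setD1P[_] /D2.
have starD' v := edges_at_sub v (subsetDl D [set e0]).
(* A colour missing both at [x] and at the far end of a reachable edge would permit a shift. *)
have unshift c1 e a : proper_on (D :\ e0) c1 -> connect (fan_step (D :\ e0) c1 x) e0 e ->
    a \in missing (D :\ e0) c1 x -> a \notin missing (D :\ e0) c1 (other x e).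
  move=> c1P /connectP[p /shortenP[q qp qu _ ->]] ax; apply/negP => ay.
  by apply: nocol; apply: fan_shift qu ax ay.
set step := fan_step (D :\ e0) c x.
have reach_star e : connect step e0 e -> e \in edges_at D x.
  case/connectP=> p; case/lastP: p => [_ -> //|p f]; rewrite rcons_path last_rcons.
  by move=> /and3P[_ fx _] ->; apply: subsetP fx.
have [a ax] : exists a, a \in missing (D :\ e0) c x.
  apply/set0Pn; rewrite -card_gt0; have := card_missing (D :\ e0) c x.
  suff /proper_card : edges_at (D :\ e0) x \proper edges_at D x by lia.
  by apply/properP; split => //; exists e0 => //; rewrite !inE eqxx.
have disj e f b : connect step e0 e -> connect step e0 f ->
    b \in missing (D :\ e0) c (other x e) -> b \in missing (D :\ e0) c (other x f) ->
    other x e = other x f.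
  move=> re rf be bf; apply/eqP; apply/negP => /negP nef.
  (* Cutting the fan before its first edge of colour [b] yields [g], whose far end misses [b] and
     which is reached without using colour [b]. Such a fan survives the switch. *)
  pose stepb : rel E := [rel g h | step g h && (c h != b)].
  have [g rg bg] : exists2 g, connect stepb e0 g & b \in missing (D :\ e0) c (other x g).
    have: connect stepb e0 e \/ exists2 g, connect stepb e0 g & b \in missing (D :\ e0) c (other x g).
      case/connectP: re => p; elim/last_ind: p (e) => [|p h IH] e1 /=; first by move=> _ ->; left.
      rewrite rcons_path last_rcons => /andP[pp st] ->.
      case: (IH _ pp erefl) => [rl|]; last by right.
      case: (eqVneq (c h) b) => [hb|hb].
        by right; exists (last e0 p) => //; case/andP: st; rewrite hb.
      by left; apply: connect_trans rl (connect1 _); apply/andP.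
    by case=> // ?; exists e.
  set K := kempe (D :\ e0) c x a b; set c' := kempe_switch (D :\ e0) c x a b.
  have c'P : proper_on (D :\ e0) c' by apply: kempe_switch_proper.
  have c'x h : h \in edges_at (D :\ e0) x -> c' h = c h.
    by move=> hx; rewrite /c' (kempe_switchE _ _ _ D'2 cP hx) kempe_refl.
  have nax h : h \in edges_at (D :\ e0) x -> c h != a by apply/missingP.
  have ax' : a \in missing (D :\ e0) c' x by rewrite missing_switch // kempe_refl.
  have stepb' g1 g2 : stepb g1 g2 -> fan_step (D :\ e0) c' x g1 g2.
    move=> /andP[/andP[g2x g12] g2b]; apply/andP; split=> //.
    rewrite c'x // missing_switch //; case: ifP => // _.
    by rewrite tpermD // eq_sym // nax.
  have rb g1 : connect stepb e0 g1 -> connect (fan_step (D :\ e0) c' x) e0 g1.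
    by apply: connect_sub => g2 g3 /stepb'/connect1.
  (* Otherwise the switch would make [a] missing at the far end of [g]. *)
  have gK : other x g \in K.
    apply/negPn/negP => gK; have /negP := unshift _ _ _ c'P (rb _ rg) ax'; apply.
    by rewrite missing_switch // (negbTE gK) tpermL.
  (* One of [e], [f] has a far end different from that of [g]; by [kempe_ends] it lies outside the
     component. *)
  have [h [rh bh hg]] : exists h, [/\ connect step e0 h, b \in missing (D :\ e0) c (other x h)
      & other x h != other x g].
    case: (eqVneq (other x e) (other x g)) => [eg|]; last by exists e.
    by exists f; split; rewrite // -eg eq_sym.
  have hK : other x h \notin K.
    apply: contraNN hg => hK; apply/eqP.
    by apply: (kempe_ends _ _ _ _ _ hK gK) => //; apply/missingP.
  (* An edge of colour [b] on the fan to [h] is entered directly from [g], whose far end still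
     misses [b]. *)
  have rh' : connect (fan_step (D :\ e0) c' x) e0 h.
    case/connectP: rh => p + ->; elim/last_ind: p => [|p q IH] //=.
    rewrite rcons_path last_rcons => /andP[/IH rl st].
    case: (eqVneq (c q) b) => [qb|qb]; last first.
      by apply: connect_trans rl (connect1 (stepb' _ _ _)); apply/andP.
    apply: connect_trans (rb _ rg) (connect1 _); case/andP: st => qx _.
    by apply/andP; split => //; rewrite c'x // qb missing_switch // gK.
  have /negP := unshift _ _ _ c'P rh' ax'; apply.
  by rewrite missing_switch // (negbTE hK) tpermL.
pose Z := [set e | connect step e0 e].
pose Y := other x @: Z.
have zY : #|Z| <= \sum_(y in Y) #|edges_at D x :&: edges_at D y|.
  rewrite -sum1_card (partition_big (other x) (mem Y)) /=; last by move=> e eZ; apply: imset_f.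
  apply: leq_sum => y _; rewrite sum1dep_card; apply: subset_leq_card.
  apply/subsetP=> e; rewrite inE [e \in Z]inE => /andP[/reach_star ex /eqP <-].
  by rewrite inE ex (edges_at_other D2 ex).
(* Each missing colour is charged to the reachable edge carrying it, once by [disj]; strictness
   comes from [e0], which is reachable but uncoloured. *)
have Yz : \sum_(y in Y) #|missing (D :\ e0) c y| < #|Z|.
  have e0Z : e0 \in Z by rewrite inE connect0.
  rewrite (cardsD1 e0) e0Z add1n ltnS -sum1_card.
  apply: (@leq_trans (\sum_(y in Y) #|[set f in Z :\ e0 | c f \in missing (D :\ e0) c y]|)).
    apply: leq_sum => _ /imsetP[e eZ ->]; rewrite inE in eZ.
    apply: leq_trans (leq_imset_card c _); apply: subset_leq_card; apply/subsetP=> b be.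
    have : b \notin missing (D :\ e0) c x by apply: contraL be; apply: unshift.
    rewrite inE negb_forall_in => /exists_inP[f fx]; rewrite negbK => /eqP fb.
    rewrite -fb; apply: imset_f; rewrite !inE fb; rewrite inE in be; rewrite be andbT.
    have -> : f != e0 by move: fx; rewrite !inE => /andP[/andP[]].
    apply: connect_trans eZ (connect1 _); apply/andP; split=> //.
    by rewrite fb inE.
  under eq_bigr => y _ do rewrite -sum1dep_card.
  rewrite (exchange_big_dep (mem (Z :\ e0))) /=; last by move=> y f _ /andP[].
  apply: leq_sum => f fZ; rewrite sum1dep_card.
  apply/card_le1_eqP => y1 y2; rewrite !inE => /andP[/imsetP[e1 e1Z ->] /andP[_ m1]].
  move=> /andP[/imsetP[e2 e2Z ->] /andP[_ m2]]; rewrite !inE in e1Z e2Z.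
  by apply: (disj _ _ (c f)); rewrite ?inE.
have : \sum_(y in Y) #|edges_at D x :&: edges_at D y| <= \sum_(y in Y) #|missing (D :\ e0) c y|.
  apply: leq_sum => _ /imsetP[e eZ ->]; rewrite inE in eZ.
  have ex := reach_star _ eZ; have [_ nx] := endsE D2 ex.
  have := degy _ nx; have := card_missing (D :\ e0) c (other x e).
  have := subset_leq_card (starD' (other x e)).
  have -> : edges_at D x :&: edges_at D (other x e) != set0.
    by apply/set0Pn; exists e; rewrite inE ex (edges_at_other D2 ex).
  by move=> ? ? /(_ isT); lia.
by lia.
Qed.

(** Induction on the edges: the fan is always centred at an end in [R] of the removed edge, so
    degree plus multiplicity is bounded only for pairs with a member in [R]. *)
Theorem multigraph_vizing D (R : {set V}) : 0 < k -> loopless D ->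
    {in D, forall e, exists2 x, x \in R & x \in ends e} ->
    (forall x, x \in R -> #|edges_at D x| <= k) ->
    (forall x y, x \in R -> y != x -> edges_at D x :&: edges_at D y != set0 ->
      #|edges_at D y| + #|edges_at D x :&: edges_at D y| <= k) ->
  exists c : E -> 'I_k, proper_on D c.
Proof.
move=> k0; have [n] := ubnP #|D|; elim: n D => // n IH D Dn D2 DR degR degy.
have [D0|[e eD]] := set_0Vmem D.
  by exists (fun=> Ordinal k0) => e f v; rewrite D0 !inE.
have sD := subsetDl D [set e].
have [|e1 /setD1P[_]|e1 /setD1P[_]|x xR|x y xR yx xy|c cP] := IH (D :\ e).
- by rewrite -ltnS (leq_trans _ Dn) // ltnS [X in _ < X](cardsD1 e) eD.
- exact: D2.
- exact: DR.
- by apply: leq_trans (degR _ xR); apply/subset_leq_card/edges_at_sub.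
- have sS : edges_at (D :\ e) x :&: edges_at (D :\ e) y \subset edges_at D x :&: edges_at D y.
    by apply: setISS; apply: edges_at_sub.
  apply: leq_trans (degy x y xR yx _); first by apply: leq_add; apply: subset_leq_card; rewrite ?edges_at_sub.
  by apply: contraNneq xy => xy0; rewrite -subset0 -xy0.
have [x xR xe] := DR _ eD.
apply: (vizing_extend D2 _ cP (degR _ xR)); first by rewrite inE eD.
by move=> y; apply: degy.
Qed.

End Fans.
End Multigraph.

(** * Growth of the number of valid partial assignments *)

(** A union bound; keeping the factor [M] on the left avoids dividing by powers of [B]. *)
Lemma leq_mul_bigcup (T T' : finType) (P : {set T}) (F : T -> {set T'}) M m :
  {in P, forall i, M * #|F i| <= m} -> M * #|\bigcup_(i in P) F i| <= #|P| * m.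
Proof.
move=> FP; apply: (@leq_trans (\sum_(i in P) M * #|F i|)); last first.
  by rewrite -sum_nat_const; apply: leq_sum.
rewrite -big_distrr leq_mul2l; apply/orP; right.
elim/big_rec2: _ => [|i A n _ An]; first by rewrite cards0.
by apply: leq_trans (leq_card_setU _ _).1 _; rewrite leq_add2l.
Qed.

Lemma leq_card_fibres (T T' : finType) (X : {set T}) (Y : {set T'}) (f : T -> T') n :
    {in X, forall t, f t \in Y} ->
    {in Y, forall y, #|[set t in X | f t == y]| <= n} -> #|X| <= n * #|Y|.
Proof.
move=> XY fib; rewrite -sum1_card (partition_big f (mem Y)) //= mulnC -sum_nat_const.
by apply: leq_sum => y yY; rewrite sum1dep_card fib.
Qed.

Lemma geq_card_fibres (T T' : finType) (X : {set T}) (Y : {set T'}) (f : T -> T') n :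
    {in X, forall t, f t \in Y} ->
    {in Y, forall y, n <= #|[set t in X | f t == y]|} -> n * #|Y| <= #|X|.
Proof.
move=> XY fib; rewrite -[#|X|]sum1_card (partition_big f (mem Y)) //= mulnC -sum_nat_const.
by apply: leq_sum => y yY; rewrite sum1dep_card fib.
Qed.

Section Counting.

Variables I C : finType.

Notation partial := {ffun I -> option C}.

Definition supp (p : partial) : {set I} := [set i | p i != None].

Definition restr (S : {set I}) (p : partial) : partial :=
  [ffun i => if i \in S then p i else None].

Definition extend (p : partial) i a : partial :=
  [ffun j => if j == i then Some a else p j].

Lemma suppP (p : partial) i : reflect (exists a, p i = Some a) (i \in supp p).
Proof.
by rewrite inE; case: (p i) => [a|]; constructor; [exists a | case].
Qed.

Lemma supp_restr (S : {set I}) p : S \subset supp p -> supp (restr S p) = S.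
Proof.
move=> /subsetP Sp; apply/setP=> i; rewrite inE ffunE; case: ifP => //.
by move=> /Sp; rewrite inE.
Qed.

Lemma restr_restr (S S' : {set I}) p : S \subset S' -> restr S (restr S' p) = restr S p.
Proof.
by move=> /subsetP SS'; apply/ffunP=> i; rewrite !ffunE; case: ifP => // /SS' ->.
Qed.

Lemma restr_sub S p i a : restr S p i = Some a -> p i = Some a.
Proof. by rewrite ffunE; case: ifP. Qed.

Lemma restr_extend (S : {set I}) p i a : i \notin S -> supp p = S -> restr S (extend p i a) = p.
Proof.
move=> iS pS; apply/ffunP=> j; rewrite !ffunE; case: ifP => jS.
  by case: eqVneq => // ji; rewrite -ji jS in iS.
by apply/esym/eqP; apply: contraFT jS; rewrite -pS inE.
Qed.

Lemma supp_extend p i a : supp (extend p i a) = i |: supp p.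
Proof. by apply/setP=> j; rewrite in_setU1 !inE ffunE; case: (j == i). Qed.

Variables (ok : pred partial) (B : nat).
Hypothesis ok_restr : forall S p, ok p -> ok (restr S p).

Definition oks (S : {set I}) : {set partial} := [set p | (supp p == S) && ok p].

(** All subsets [J] are allowed, so that a counting step may forget several earlier choices at
    once. *)
Definition growing (S : {set I}) :=
  forall J : {set I}, J \subset S -> B ^ #|J| * #|oks (S :\: J)| <= #|oks S|.

(** One slot of [J] is paid for by the one-step hypothesis, the others by growth of the smaller
    set. *)
Lemma oks_growing (dom : {set I}) :
    (forall (S : {set I}) s, S \subset dom -> s \in dom -> s \notin S -> growing S ->
       B * #|oks S| <= #|oks (s |: S)|) ->
  forall S : {set I}, S \subset dom -> growing S.
Proof.
move=> step S; have [n] := ubnP #|S|; elim: n S => // n IH S Sn Sdom J JS.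
have [->|[s sJ]] := set_0Vmem J; first by rewrite cards0 mul1n setD0.
have sS := subsetP JS _ sJ; have S'dom : S :\ s \subset dom by apply: subset_trans (subsetDl _ _) _.
have gS : growing (S :\ s).
  by apply: IH => //; rewrite -ltnS (leq_trans _ Sn) // ltnS [X in _ < X](cardsD1 s) sS.
have := step _ s S'dom (subsetP Sdom _ sS) _ gS; rewrite setD11 setD1K // => /(_ isT).
apply: leq_trans; rewrite (cardsD1 s) sJ expnS -mulnA leq_mul2l; apply/orP; right.
apply: leq_trans (gS (J :\ s) (setSD _ JS)); rewrite leq_mul2l; apply/orP; right.
apply: eq_leq; congr #|oks _|; apply/setP=> i; rewrite !inE; case: (eqVneq i s) => [->|] //=.
by rewrite sJ.
Qed.

(** The empty assignment is valid, so growth yields at least [B ^ #|dom|] valid assignments on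
    [dom]. *)
Lemma oks_total (dom : {set I}) : 0 < B -> ok [ffun=> None] ->
    (forall (S : {set I}) s, S \subset dom -> s \in dom -> s \notin S -> growing S ->
       B * #|oks S| <= #|oks (s |: S)|) ->
  exists p, ok p /\ supp p = dom.
Proof.
move=> B0 ok0 /oks_growing/(_ _ (subxx dom)) /(_ _ (subxx dom)); rewrite setDv => le.
have : 0 < #|oks dom|.
  apply: leq_trans le; rewrite muln_gt0 expn_gt0 B0 /= card_gt0; apply/set0Pn.
  exists [ffun=> None]; rewrite inE ok0 andbT; apply/eqP/setP => i.
  by rewrite !inE ffunE.
by rewrite card_gt0 => /set0Pn[p]; rewrite inE => /andP[/eqP ? ?]; exists p.
Qed.

(** Validity is required only before the choice at [s]; the choices that break it are counted and
    subtracted later. *)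
Definition extensions (S : {set I}) s (L : partial -> {set C}) : {set partial} :=
  [set p | [&& supp p == s |: S, ok (restr S p)
             & if p s is Some a then a \in L (restr S p) else false]].

Lemma card_extensions (S : {set I}) s (L : partial -> {set C}) n : s \notin S ->
    {in oks S, forall p, n <= #|L p|} ->
  n * #|oks S| <= #|extensions S s L|.
Proof.
move=> sS Ln; apply: (@geq_card_fibres _ _ _ _ (restr S)) => [p|p pS].
  rewrite !inE => /and3P[/eqP pS -> _]; rewrite andbT supp_restr // pS.
  exact: subsetUr.
apply: leq_trans (Ln p pS) _; move: (pS); rewrite inE => /andP[/eqP sp okp].
have inj : injective (extend p s).
  by move=> a b /ffunP/(_ s); rewrite !ffunE eqxx; case.
rewrite -(card_imset _ inj); apply: subset_leq_card; apply/subsetP=> _ /imsetP[a aL ->].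
by rewrite !inE restr_extend // supp_extend sp !eqxx okp ffunE eqxx aL.
Qed.

(* Forgetting the choices at [s] and at the slots of [J] costs a factor [n] in the count of a
   family [X], and the slots of [J] are paid back by growth. *)
Lemma card_flawed (T : finType) (S J : {set I}) s (X : {set partial})
    (h : partial -> T) (H : partial -> {set T}) n :
    growing S -> (0 < #|X| -> J \subset S) ->
    {in X, forall p, supp p = s |: S /\ ok (restr S p)} ->
    {in X, forall p, h p \in H (restr (S :\: J) p)} ->
    {in X &, forall p p', restr (S :\: J) p = restr (S :\: J) p' -> h p = h p' -> p = p'} ->
    {in oks (S :\: J), forall p, #|H p| <= n} ->
  B ^ #|J| * #|X| <= n * #|oks S|.
Proof.
move=> gS JS Xok XH Xinj Hn; have [->|X0] := posnP #|X|; first by rewrite muln0.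
apply: leq_trans (leq_mul (leqnn n) (gS _ (JS X0))); rewrite mulnCA leq_mul2l; apply/orP; right.
apply: (@leq_card_fibres _ _ _ _ (restr (S :\: J))) => [p /Xok[sp okp]|p /Hn pH].
  rewrite inE -(restr_restr p (subsetDl S J)) ok_restr // andbT restr_restr ?subsetDl //.
  by rewrite supp_restr // sp (subset_trans (subsetDl _ _)) // subsetUr.
apply: leq_trans pH; rewrite -(card_in_imset (f := h)).
  apply/subset_leq_card/subsetP=> _ /imsetP[p' + ->]; rewrite inE => /andP[p'X /eqP <-].
  exact: XH.
move=> p1 p2; rewrite !inE => /andP[p1X /eqP r1] /andP[p2X /eqP r2]; apply: Xinj => //.
by rewrite r1.
Qed.

End Counting.

(** * Picking the edges to recolour *)

Lemma subset_of_card (T : finType) (S : {set T}) n :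
  n <= #|S| -> exists2 A : {set T}, A \subset S & #|A| = n.
Proof.
move=> nS; exists [set x in take n (enum S)].
  by apply/subsetP=> x; rewrite inE => /mem_take; rewrite mem_enum.
rewrite cardsE (card_uniqP (take_uniq _ (enum_uniq _))) size_take -cardE.
by case: ltngtP nS.
Qed.

Section Picks.

Variables (E V C : finType) (ends : E -> {set V}) (D : {set E}) (U : {set V}) (c : E -> C).
Variables (d q B : nat) (A : V * bool -> {set E}).

Notation star := (edges_at ends D).
Notation other := (other ends).
Notation partial := {ffun V * bool -> option E}.

Hypotheses (D2 : loopless ends D) (cP : proper_on ends D c).
Hypothesis deg_le : forall v, #|star v| <= d.
Hypothesis simpleU : {in U &, forall u v, u != v -> #|star u :&: star v| <= 1}.
Hypothesis A_star : forall s, A s \subset star s.1.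
Hypothesis A_card : forall s, s.1 \in U -> #|A s| = q.
Hypothesis A_disj : forall u b b' e, e \in A (u, b) -> e \in A (u, b') -> b = b'.

Definition slots : {set V * bool} := [set s | s.1 \in U].

Definition picked (p : partial) : {set E} := [set e | [exists s, p s == Some e]].

Definition picked_in (p : partial) w : {set E} :=
  [set e | (w \in ends e) && [exists s : V * bool, (p s == Some e) && (s.1 != w)]].

(* If the colours remaining at [u] and at [v] coincide, then the colour of each pick of [u] is
   either absent at [v] or removed from [v]: this is [flaw p u v], and all but 17 = 15 + 2 of the
   colours at [u] occur at [v]: this is [risky u v]. *)
Definition matched (p : partial) v a :=
  (c a \in c @: star v) ==> [exists e in picked p, (v \in ends e) && (c e == c a)].

Definition flaw (p : partial) u v :=
  [forall b, if p (u, b) is Some a then matched p v a else false].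

Definition nbr u v := (u != v) && (star u :&: star v != set0).

Definition risky u v := [&& u \in U, v \in U, nbr u v & #|c @: star u :\: c @: star v| <= 17].

Definition legal (p : partial) :=
  [forall s, if p s is Some e then (s.1 \in U) && (e \in A s) else true].

Definition picks_ok (p : partial) :=
  [&& legal p, [forall w, #|picked_in p w| <= 15]
    & [forall u, forall v, risky u v ==> ~~ flaw p u v]].

Lemma legalP p s e : legal p -> p s = Some e -> s.1 \in U /\ e \in A s.
Proof. by move=> /forallP/(_ s) + ps; rewrite ps => /andP[]. Qed.

(** Forgetting picks lowers the loads and cannot create a flaw: a flaw needs both picks of [u], and
    being matched is monotone in the picked edges. *)
Lemma picks_ok_restr S p : picks_ok p -> picks_ok (restr S p).
Proof.
case/and3P=> lp /forallP ip /forallP fp.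
have pk e : e \in picked (restr S p) -> e \in picked p.
  by rewrite !inE => /existsP[s /eqP/restr_sub ps]; apply/existsP; exists s; rewrite ps.
apply/and3P; split.
- apply/forallP=> s; case ps: (restr S p s) => [e|] //.
  by apply/andP; apply: legalP lp (restr_sub ps).
- apply/forallP=> w; apply: leq_trans (ip w); apply/subset_leq_card/subsetP=> e.
  rewrite !inE => /andP[-> /existsP[s /andP[/eqP/restr_sub ps sw]]] /=.
  by apply/existsP; exists s; rewrite ps eqxx.
- apply/forallP=> u; apply/forallP=> v; apply/implyP=> uv.
  apply: contra (implyP (forallP (fp u) v) uv) => /forallP fl.
  apply/forallP=> b; have := fl b; case ps: (restr S p (u, b)) => [a|] //.
  rewrite (restr_sub ps) => /implyP m; apply/implyP=> /m /exists_inP[e /pk ep ev].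
  by apply/exists_inP; exists e.
Qed.

Lemma picks_ok_none : picks_ok [ffun=> None].
Proof.
apply/and3P; split.
- by apply/forallP=> s; rewrite ffunE.
- apply/forallP=> w; rewrite (_ : picked_in _ _ = set0) ?cards0 //.
  apply/setP=> e; rewrite !inE; apply/negbTE; rewrite negb_and; apply/orP; right.
  by apply/existsPn=> s; rewrite ffunE.
- apply/forallP=> u; apply/forallP=> v; apply/implyP=> _; apply/forallPn.
  by exists true; rewrite ffunE.
Qed.

(** The owner of either slot is the end of [e] other than [w], and the two slots of one vertex have
    disjoint candidate sets. *)
Lemma slot_uniq s s' w e : e \in A s -> e \in A s' -> s.1 != w -> s'.1 != w ->
  w \in ends e -> s = s'.
Proof.
move=> es es' sw s'w we.
have sx := subsetP (A_star s) _ es; have sx' := subsetP (A_star s') _ es'.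
have wx : e \in star w by move: sx; rewrite !inE we => /andP[->].
have s1 : s.1 = s'.1 by rewrite (other_uniq D2 wx sx sw) (other_uniq D2 wx sx' s'w).
case: s s' s1 es es' {sw s'w sx sx'} => [u b] [u' b'] /= <- es es'.
by rewrite (A_disj es es').
Qed.

Definition picked_at (p : partial) v : {set E} := [set e in picked p | v \in ends e].

Lemma card_picked_at p v : picks_ok p -> #|picked_at p v| <= 15 + (v \in U).*2.
Proof.
case/and3P=> lp /forallP ip _.
pose out := [set e | [exists b, p (v, b) == Some e]].
have sub : picked_at p v \subset picked_in p v :|: out.
  apply/subsetP=> e; rewrite !inE => /andP[/existsP[[u b] pe] ->] /=.
  case: (eqVneq u v) => uv.
    by apply/orP; right; apply/existsP; exists b; rewrite -uv.
  by apply/orP; left; apply/existsP; exists (u, b); rewrite pe.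
apply: leq_trans (subset_leq_card sub) _; apply: leq_trans (leq_card_setU _ _).1 _.
apply: leq_add => //; case vU: (v \in U); last first.
  rewrite leqn0 cards_eq0; apply/eqP/setP=> e; rewrite !inE; apply/negbTE/existsPn => b.
  by apply/eqP => /(legalP lp)[]; rewrite vU.
have injS : injective (@Some E) by move=> ? ? [].
rewrite -(card_imset _ injS).
apply: leq_trans (_ : #|[set p (v, b) | b in [set: bool]]| <= 2); last first.
  by apply: leq_trans (leq_imset_card _ _) _; rewrite cardsT card_bool.
apply/subset_leq_card/subsetP=> _ /imsetP[e + ->]; rewrite inE => /existsP[b /eqP <-].
exact: imset_f.
Qed.

Lemma card_nbr v : #|[set u | nbr u v]| <= d.
Proof.
apply: leq_trans (deg_le v); apply: leq_trans (leq_imset_card (other v) _).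
apply/subset_leq_card/subsetP=> u; rewrite inE => /andP[uv /set0Pn[e]].
by rewrite in_setI => /andP[eu ev]; rewrite (other_uniq D2 ev eu uv); apply: imset_f.
Qed.

Lemma nbrC u v : nbr u v = nbr v u.
Proof. by rewrite /nbr eq_sym setIC. Qed.

(** The candidates for a pick of [u] in a flaw, once the picked edges at [v] are known to lie in
    [X]. *)
Definition matchable u v (X : {set E}) : {set E} :=
  [set a in star u | (c a \in c @: star u :\: c @: star v) || (c a \in c @: X)].

Lemma card_matchable u v (X : {set E}) n : risky u v -> #|X| <= n -> #|matchable u v X| <= 17 + n.
Proof.
case/and4P=> _ _ _ r Xn.
have inj : {in matchable u v X &, injective c}.
  by move=> a a' /setIdP[au _] /setIdP[a'u _]; apply: cP au a'u.
rewrite -(card_in_imset inj); apply: leq_trans (leq_add r (leq_trans (leq_imset_card c X) Xn)).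
apply: leq_trans (leq_card_setU _ _).1; apply/subset_leq_card/subsetP=> _ /imsetP[a + ->].
by rewrite inE in_setU => /andP[].
Qed.

Lemma flaw_matchable p u v b (X : {set E}) : legal p -> flaw p u v -> picked_at p v \subset X ->
  exists2 a, p (u, b) = Some a & a \in matchable u v X.
Proof.
move=> lp /forallP/(_ b) + /subsetP pX; case pu: (p (u, b)) => [a|] // ma; exists a => //.
have [_ au] := legalP lp pu; have {}au := subsetP (A_star _) _ au.
apply/setIdP; split=> //; rewrite in_setD (imset_f c au) andbT.
case cav: (c a \in c @: star v) ma => //=; rewrite /matched cav /= => /exists_inP[e ep].
move=> /andP[ve /eqP <-]; apply: imset_f; apply: pX.
by rewrite inE ep.
Qed.

Section Step.

Variables (S : {set V * bool}) (s : V * bool).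
Hypotheses (Sdom : S \subset slots) (sdom : s \in slots) (sS : s \notin S).
Hypothesis gS : growing picks_ok B S.

Let X := extensions picks_ok S s (fun=> A s).

Lemma picks_supp p : p \in X -> supp p = s |: S /\ picks_ok (restr S p).
Proof. by rewrite inE => /and3P[/eqP]. Qed.

Lemma picks_new p : p \in X -> exists2 e, p s = Some e & e \in A s.
Proof. by rewrite inE => /and3P[_ _]; case: (p s) => // e; exists e. Qed.

Lemma picks_old p s' e : p \in X -> p s' = Some e -> s' != s -> restr S p s' = Some e.
Proof.
move=> /picks_supp[sp _] ps ss; rewrite ffunE.
have : s' \in supp p by apply/suppP; exists e.
by rewrite sp !inE (negbTE ss) /= => ->.
Qed.

Lemma picks_legal p : p \in X -> legal p.
Proof.
move=> pX; have [e ps es] := picks_new pX; have [_ /and3P[lp _ _]] := picks_supp pX.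
apply/forallP=> s'; case ps': (p s') => [e'|] //.
case: (eqVneq s' s) => [ss|/(picks_old pX ps')/(legalP lp)/andP//].
by move: ps'; rewrite ss ps => -[<-]; rewrite es andbT; have := sdom; rewrite inE.
Qed.

Lemma picks_eq (J : {set V * bool}) p p' : p \in X -> p' \in X ->
    restr (S :\: J) p = restr (S :\: J) p' ->
  {in s |: J, forall t, p t = p' t} -> p = p'.
Proof.
move=> /picks_supp[sp _] /picks_supp[sp' _] /ffunP r pJ; apply/ffunP=> t.
case: (boolP (t \in s |: J)) => [/pJ //|]; rewrite !inE negb_or => /andP[ts tJ].
have := r t; rewrite !ffunE in_setD tJ /=; case: (boolP (t \in S)) => // tS _.
have none (p1 : partial) : supp p1 = s |: S -> p1 t = None.
  move=> sp1; apply/eqP; have : t \notin supp p1 by rewrite sp1 !inE negb_or ts.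
  by rewrite inE negbK.
by rewrite !none.
Qed.

(** The new pick [e] meets, at its far end, the earlier picks [K] owned by other vertices. *)
Definition bad_degree e (K : {set E}) : {set partial} :=
  [set p in X | (p s == Some e) && [forall k in K, exists t, [&& t \in S, p t == Some k & t.1 != other s.1 e]]].

(** Once [e] and [K] are fixed, each edge of [K] can be held by only one slot. Forgetting these 15
    slots therefore loses no information, and nothing has to be recorded: the record type is
    [unit]. *)
Lemma card_bad_degree e (K : {set E}) : K \subset star (other s.1 e) -> #|K| = 15 ->
  B ^ 15 * #|bad_degree e K| <= #|oks picks_ok S|.
Proof.
move=> /subsetP Ke K15; set w := other s.1 e.
have [->|] := set_0Vmem (bad_degree e K); first by rewrite cards0 muln0.
case=> p0; rewrite inE => /and3P[p0X _ /forall_inP p0K].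
have oldA p t k : p \in X -> t \in S -> p t = Some k -> k \in A t.
  move=> pX tS pt; have [_ /and3P[lp _ _]] := picks_supp pX.
  by apply: (legalP lp _).2; rewrite ffunE tS.
(* The slots are read off from one member [p0]; by [slot_uniq] they are the same for every
   member. *)
pose J := [set t in S | [exists k in K, (p0 t == Some k) && (t.1 != w)]].
have injJ : {in J &, injective p0}.
  move=> t t'; rewrite !inE => /andP[tS /exists_inP[k kK /andP[/eqP pt tw]]].
  move=> /andP[tS' /exists_inP[k' _ /andP[/eqP pt' tw']]] ptt.
  have kk : k' = k by move: pt'; rewrite -ptt pt => -[].
  move: pt'; rewrite kk => pt'; apply: slot_uniq (oldA _ _ _ p0X tS pt) (oldA _ _ _ p0X tS' pt') tw tw' _.
  by have := Ke _ kK; rewrite inE => /andP[].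
have injS : injective (@Some E) by move=> ? ? [].
have J15 : #|J| = 15.
  rewrite -K15 -(card_in_imset injJ) -(card_imset _ injS); congr #|pred_of_set _|.
  apply/setP=> o; apply/imsetP/imsetP => [[t + ->]|[k kK ->]].
    by rewrite inE => /andP[_ /exists_inP[k kK /andP[/eqP pt _]]]; exists k.
  have /existsP[t /and3P[tS /eqP pt tw]] := p0K _ kK; exists t => //.
  by rewrite inE tS; apply/exists_inP; exists k; rewrite // pt eqxx.
rewrite -J15 -[X in _ <= X]mul1n.
apply: (@card_flawed _ _ picks_ok B picks_ok_restr unit S J s _ (fun=> tt) (fun=> setT)) => //.
- by move=> _; apply/subsetP=> t; rewrite inE => /andP[].
- by move=> p; rewrite inE => /andP[/picks_supp].
- move=> p p' /setIdP[pX /andP[/eqP ps /forall_inP pK]] /setIdP[p'X /andP[/eqP p's /forall_inP p'K]] r _.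
  apply: (picks_eq pX p'X r) => t; rewrite in_setU1 => /orP[/eqP->|]; first by rewrite ps.
  rewrite inE => /andP[tS /exists_inP[k kK /andP[/eqP pt tw]]].
  suff one p1 : p1 \in X -> [exists t, [&& t \in S, p1 t == Some k & t.1 != w]] -> p1 t = Some k.
    by rewrite (one _ pX (pK _ kK)) (one _ p'X (p'K _ kK)).
  move=> p1X /existsP[t' /and3P[tS' /eqP pt' tw']].
  have -> // : t = t'.
  apply: slot_uniq (oldA _ _ _ p0X tS pt) (oldA _ _ _ p1X tS' pt') tw tw' _.
  by have := Ke _ kK; rewrite inE => /andP[].
- by move=> p _; rewrite cardsT card_unit.
Qed.

Lemma flaw_slots p u v b : p \in X -> flaw p u v -> u != s.1 -> (u, b) \in S.
Proof.
move=> pX /forallP/(_ b); case pu: (p (u, b)) => [a|] // _ us.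
have := picks_old pX pu; rewrite ffunE; case: ifP => // _ H.
by have: (u, b) != s by [apply: contraNneq us => <-]; move/H.
Qed.

(** What remains visible of the picked edges at [v] after the picks of [u] are forgotten: a
    forgotten pick at [v] can only be an edge joining [u] and [v]. *)
Definition known u v (p : partial) : {set E} := picked_at p v :|: star u :&: star v.

Lemma card_known u v p : picks_ok p -> risky u v -> #|known u v p| <= 18.
Proof.
move=> picks_ok /and4P[uU vU /andP[uv _] _]; apply: leq_trans (leq_card_setU _ _).1 _.
by have := card_picked_at v picks_ok; rewrite vU; have := simpleU uU vU uv; lia.
Qed.

Lemma picked_known (J : {set V * bool}) p u v : p \in X -> {in J, forall t, t.1 = u} ->
  picked_at p v \subset
    known u v (restr (S :\: J) p) :|: [set e | (p s == Some e) && (s.1 != u)].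
Proof.
move=> pX Ju; apply/subsetP=> e /setIdP[]; rewrite inE => /existsP[t /eqP pt] ve.
have [_ et] := legalP (picks_legal pX) pt; have {}et := subsetP (A_star _) _ et.
rewrite in_setU [e \in known _ _ _]in_setU; case: (eqVneq t.1 u) => tu.
  rewrite -tu in_setI et; apply/orP; left; apply/orP; right.
  by move: et; rewrite !inE ve => /andP[->].
case: (eqVneq t s) => ts; first by rewrite orbC inE -ts pt eqxx tu.
apply/orP; left; apply/orP; left; rewrite inE ve andbT inE; apply/existsP; exists t.
have tJ : t \notin J by apply: contraNN tu => /Ju ->.
rewrite ffunE in_setD tJ /=; have := picks_old pX pt ts; rewrite ffunE.
by case: ifP => // _ ->.
Qed.

Definition bad_owner v : {set partial} := [set p in X | flaw p s.1 v].

(** Both picks of [u] are among 17 + 18 matchable edges, whence 1225 = 35 * 35. Besides the new slot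
    only the other slot of [u] is forgotten, which gives one factor [B]. *)
Lemma card_bad_owner v : risky s.1 v -> B * #|bad_owner v| <= 1225 * #|oks picks_ok S|.
Proof.
move=> sv; set u := s.1; pose J := [set (u, ~~ s.2)].
have sE : s = (u, s.2) by apply: surjective_pairing.
pose M p : {set option E} := Some @: matchable u v (known u v p).
have -> : B = B ^ #|J| by rewrite cards1 expn1.
have JS : 0 < #|bad_owner v| -> J \subset S.
  rewrite card_gt0 => /set0Pn[p /setIdP[pX /forallP/(_ (~~ s.2))]]; rewrite sub1set.
  case pu: (p _) => [a|] // _; have := picks_old pX pu; rewrite ffunE; case: ifP => // _ H.
  by have: (u, ~~ s.2) != s by [rewrite {2}sE; apply/eqP => -[]; case: (s.2)]; move/H.
apply: (@card_flawed _ _ picks_ok B picks_ok_restr _ S J s _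
  (fun p => (p (u, true), p (u, false))) (fun p => setX (M p) (M p))) => //.
- by move=> p /setIdP[/picks_supp].
- move=> p /setIdP[pX fl]; have Ju : {in J, forall t, t.1 = u} by move=> t /set1P->.
  have sub : picked_at p v \subset known u v (restr (S :\: J) p).
    apply: subset_trans (picked_known v pX Ju) _; rewrite subUset subxx /=.
    by apply/subsetP=> e; rewrite inE eqxx andbF.
  have mem b : p (u, b) \in M (restr (S :\: J) p).
    by have [a -> aM] := flaw_matchable b (picks_legal pX) fl sub; apply: imset_f.
  by rewrite in_setX !mem.
- move=> p p' /setIdP[pX _] /setIdP[p'X _] r [ht hf]; apply: (picks_eq pX p'X r) => t.
  rewrite !inE => /orP[/eqP->|/eqP->]; first by rewrite sE; case: (s.2).
  by case: (~~ s.2).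
- move=> p; rewrite inE => /andP[_ picks_ok]; rewrite cardsX.
  have Mle : #|M p| <= 35.
    by apply: leq_trans (leq_imset_card _ _) _; apply: card_matchable (card_known _ _).
  exact: (leq_mul Mle Mle).
Qed.

Definition bad_other e v u b : {set partial} :=
  [set p in X | [&& p s == Some e, flaw p u v
                  & [exists a, (p (u, b) == Some a) && (c a == c e)]]].

(** Both slots of [u] are forgotten. By properness the pick sharing the colour of [e] is determined;
    the other has 17 + 19 candidates, as [e] joins the 18 known edges. *)
Lemma card_bad_other e v u b : risky u v -> u != s.1 ->
  B ^ 2 * #|bad_other e v u b| <= 36 * #|oks picks_ok S|.
Proof.
move=> uv us; pose J := [set (u, true); (u, false)].
have J2 : #|J| = 2 by rewrite cards2 eqE /= eqxx.
have JP t : (t \in J) = (t.1 == u).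
  by case: t => w [] /=; rewrite !inE !eqE /= ?andbT ?andbF ?orbF.
pose M1 (p : partial) : {set option E} := Some @: [set a in star u | c a == c e].
pose M2 p : {set option E} := Some @: matchable u v (known u v p :|: [set e]).
rewrite -[in B ^ _]J2.
apply: (@card_flawed _ _ picks_ok B picks_ok_restr _ S J s _
  (fun p => (p (u, b), p (u, ~~ b))) (fun p => setX (M1 p) (M2 p))) => //.
- rewrite card_gt0 => /set0Pn[p /setIdP[pX /and3P[_ fl _]]].
  by apply/subsetP=> -[w b']; rewrite JP => /eqP /= ->; apply: flaw_slots pX fl us.
- by move=> p /setIdP[/picks_supp].
- move=> p /setIdP[pX /and3P[/eqP ps fl /existsP[a /andP[/eqP pa ca]]]].
  have Ju : {in J, forall t, t.1 = u} by move=> t; rewrite JP => /eqP.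
  have sub : picked_at p v \subset known u v (restr (S :\: J) p) :|: [set e].
    apply: subset_trans (picked_known v pX Ju) _; apply: setUS.
    by apply/subsetP=> f; rewrite inE ps => /andP[/eqP[->]]; rewrite inE.
  rewrite in_setX; apply/andP; split.
    rewrite pa; apply: imset_f; apply/setIdP; split=> //.
    by have [_ /(subsetP (A_star _))] := legalP (picks_legal pX) pa.
  by have [a' -> aM] := flaw_matchable (~~ b) (picks_legal pX) fl sub; apply: imset_f.
- move=> p p' /setIdP[pX /andP[/eqP ps _]] /setIdP[p'X /andP[/eqP p's _]] r [hb hnb].
  apply: (picks_eq pX p'X r) => -[w b']; rewrite in_setU1 JP => /orP[/eqP->|/eqP /= ->].
    by rewrite ps.
  by case: (eqVneq b' b) => [-> //|]; case: b b' hb hnb => -[].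
- move=> p; rewrite inE => /andP[_ picks_ok]; rewrite cardsX.
  have M1le : #|M1 p| <= 1.
    apply: leq_trans (leq_imset_card _ _) _; apply/card_le1_eqP => a a'.
    by move=> /setIdP[au /eqP ca] /setIdP[a'u /eqP ca']; apply: cP a'u au _; rewrite ca ca'.
  have M2le : #|M2 p| <= 17 + 19.
    apply: leq_trans (leq_imset_card _ _) _; apply: card_matchable => //.
    apply: leq_trans (leq_card_setU _ _).1 _; rewrite cards1.
    by rewrite addn1 ltnS card_known.
  exact: (leq_mul M1le M2le).
Qed.

(** An invalid extension either overloads the far end of the new pick, or has a flaw at its owner,
    or has a flaw completed by the new pick serving as partner for a pick of another vertex. *)
Lemma picks_cover : X \subset
  oks picks_ok (s |: S)
    :|: (\bigcup_(e in A s) \bigcup_(K in [set K : {set E} | K \subset star (other s.1 e) & #|K| == 15]) bad_degree e K)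
    :|: (\bigcup_(v in [set v | nbr v s.1]) if risky s.1 v then bad_owner v else set0)
    :|: (\bigcup_(e in A s) \bigcup_(v in ends e) \bigcup_(u in [set u | nbr u v])
           \bigcup_(b in [set: bool]) if risky u v && (u != s.1) then bad_other e v u b else set0).
Proof.
apply/subsetP=> p pX; have [sp /and3P[lr /forallP ir /forallP fr]] := picks_supp pX.
have [e ps es] := picks_new pX; have lp := picks_legal pX.
rewrite !in_setU.
case: (boolP [forall w, #|picked_in p w| <= 15]) => [ip|]; last first.
  rewrite negb_forall => /existsP[w]; rewrite -ltnNge => w15.
  have sub : picked_in p w \subset e |: picked_in (restr S p) w.
    apply/subsetP=> f /setIdP[wf /existsP[t /andP[/eqP pt tw]]].
    rewrite in_setU1; case: (eqVneq t s) pt => [->|ts pt]; first by rewrite ps => -[->]; rewrite eqxx.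
    by apply/orP; right; apply/setIdP; split=> //; apply/existsP; exists t; rewrite (picks_old pX pt ts) eqxx.
  have erw : e \notin picked_in (restr S p) w.
    apply: contraL w15 => ew; rewrite -leqNgt; apply: leq_trans (ir w).
    by apply: leq_trans (subset_leq_card sub) _; rewrite cardsU1 ew.
  have epw : e \in picked_in p w.
    apply: contraLR w15 => ew; rewrite -leqNgt; apply: leq_trans (ir w).
    apply/subset_leq_card/subsetP=> f fw; have := subsetP sub _ fw.
    by rewrite in_setU1; case: eqVneq fw => [->|//]; rewrite (negbTE ew).
  have [we /existsP[t /andP[/eqP pt tw]]] := setIdP epw.
  have ts : t = s.
    apply/eqP; apply: contraR erw => ts; apply/setIdP; split=> //; apply/existsP; exists t.
    by rewrite (picks_old pX pt ts) eqxx.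
  have ewo : w = other s.1 e.
    have esx := subsetP (A_star _) _ es; apply: (other_uniq D2 esx).
      by move: esx; rewrite !inE we => /andP[->].
    by rewrite eq_sym -ts.
  have K15 : #|picked_in (restr S p) w| = 15.
    apply/eqP; rewrite eqn_leq ir /=; have := subset_leq_card sub.
    by rewrite cardsU1 erw; move: w15; lia.
  apply/orP; left; apply/orP; left; apply/orP; right.
  apply/bigcupP; exists e => //; apply/bigcupP; exists (picked_in (restr S p) w).
    rewrite inE K15 eqxx andbT -ewo; apply/subsetP=> f /setIdP[wf /existsP[t' /andP[/eqP pt' _]]].
    rewrite inE wf andbT; have [_ /(subsetP (A_star _))] := legalP lr pt'.
    by rewrite inE => /andP[].
  apply/setIdP; split=> //; rewrite ps eqxx /=; apply/forall_inP=> k /setIdP[_ /existsP[t' /andP[/eqP pt' tw']]].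
  apply/existsP; exists t'; rewrite -ewo tw' (restr_sub pt') eqxx /= andbT.
  by move: pt'; rewrite ffunE; case: ifP.
case: (boolP [forall u, forall v, risky u v ==> ~~ flaw p u v]) => [fp|].
  by rewrite inE sp eqxx /picks_ok lp ip fp.
rewrite negb_forall => /existsP[u]; rewrite negb_forall => /existsP[v].
rewrite negb_imply negbK => /andP[uv fl]; have [uU vU nuv _] := and4P uv.
case: (eqVneq u s.1) => us.
  apply/orP; left; apply/orP; right; apply/bigcupP; exists v; first by rewrite inE nbrC -us.
  by rewrite -us uv; apply/setIdP; rewrite -us.
apply/orP; right.
(* Before the choice at [s] some pick [a] of [u] lacked a partner at [v]; the new partner must be
   [e]. *)
have := implyP (forallP (fr u) v) uv; rewrite negb_forall => /existsP[b].
have /forallP/(_ b) := fl; case pu: (p (u, b)) => [a|] // ma.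
have ub : (u, b) != s by apply: contraNneq us => <-.
rewrite (picks_old pX pu ub) negb_imply => /andP[cav]; rewrite negb_exists_in => /forall_inP na.
have /exists_inP[f fp /andP[vf /eqP cf]] := implyP ma cav.
have fe : f = e.
  move: fp; rewrite inE => /existsP[t /eqP pt]; case: (eqVneq t s) pt => [->|ts pt].
    by rewrite ps => -[].
  have := na f; rewrite inE vf cf eqxx; case/(_ _)/negP => //.
  by apply/existsP; exists t; rewrite (picks_old pX pt ts).
rewrite fe in vf cf; apply/bigcupP; exists e => //; apply/bigcupP; exists v => //.
apply/bigcupP; exists u; first by rewrite inE.
apply/bigcupP; exists b => //; rewrite uv us; apply/setIdP; split=> //.
by rewrite ps eqxx fl /=; apply/existsP; exists a; rewrite pu cf !eqxx.
Qed.

Hypothesis numeric : forall N a b1 b2, B ^ 15 * a <= q * ('C(d, 15) * N) ->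
  B * b1 <= d * (1225 * N) -> B ^ 2 * b2 <= q * (2 * (d * (2 * (36 * N)))) ->
  a + b1 + b2 + B * N <= q * N.

Lemma picks_step : B * #|oks picks_ok S| <= #|oks picks_ok (s |: S)|.
Proof.
have sU : s.1 \in U by have := sdom; rewrite inE.
have qX : q * #|oks picks_ok S| <= #|X|.
  by apply: card_extensions => // p _; rewrite A_card.
have := leq_trans qX (subset_leq_card picks_cover).
set BA := \bigcup_(e in A s) _; set B1 := \bigcup_(v in _) _; set B2 := \bigcup_(e in A s) _.
have hA : B ^ 15 * #|BA| <= q * ('C(d, 15) * #|oks picks_ok S|).
  rewrite -(A_card sU); apply: leq_mul_bigcup => e es.
  apply: (@leq_trans ('C(#|star (other s.1 e)|, 15) * #|oks picks_ok S|)); last first.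
    by rewrite leq_mul2r leq_bin2l ?orbT.
  rewrite -cards_draws; apply: leq_mul_bigcup => K; rewrite inE => /andP[KS /eqP K15].
  exact: card_bad_degree.
have h1 : B * #|B1| <= d * (1225 * #|oks picks_ok S|).
  apply: (@leq_trans (#|[set v | nbr v s.1]| * (1225 * #|oks picks_ok S|))); last by rewrite leq_mul2r card_nbr orbT.
  apply: leq_mul_bigcup => v _; case: ifP => [/card_bad_owner //|_].
  by rewrite cards0 muln0.
(* The factors count the choices of [e], its ends [v], the neighbours [u] of [v] and the slots of
   [u]. *)
have h2 : B ^ 2 * #|B2| <= q * (2 * (d * (2 * (36 * #|oks picks_ok S|)))).
  rewrite -(A_card sU); apply: leq_mul_bigcup => e es.
  have eD : e \in D by have := subsetP (A_star _) _ es; rewrite inE => /andP[].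
  apply: (@leq_trans (#|ends e| * (d * (2 * (36 * #|oks picks_ok S|))))); last by rewrite D2.
  apply: leq_mul_bigcup => v _.
  apply: (@leq_trans (#|[set u | nbr u v]| * (2 * (36 * #|oks picks_ok S|)))); last by rewrite leq_mul2r card_nbr orbT.
  apply: leq_mul_bigcup => u _.
  apply: (@leq_trans (#|[set: bool]| * (36 * #|oks picks_ok S|))); last by rewrite cardsT card_bool.
  apply: leq_mul_bigcup => b _.
  case: ifP => [/andP[uv us]|_]; last by rewrite cards0 muln0.
  exact: card_bad_other.
have := numeric hA h1 h2 => hn hX.
have cU (P Q : {set partial}) : #|P :|: Q| <= #|P| + #|Q| := (leq_card_setU P Q).1.
have := leq_trans hX (leq_trans (cU _ _) (leq_add (leq_trans (cU _ _) (leq_add (cU _ _) (leqnn _))) (leqnn _))).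
move=> {}hX; rewrite -(leq_add2l (#|BA| + #|B1| + #|B2|)).
by apply: leq_trans hn (leq_trans hX _); rewrite [X in _ <= X]addnC !addnA.
Qed.

End Step.

Hypothesis numeric : forall N a b1 b2, B ^ 15 * a <= q * ('C(d, 15) * N) ->
  B * b1 <= d * (1225 * N) -> B ^ 2 * b2 <= q * (2 * (d * (2 * (36 * N)))) ->
  a + b1 + b2 + B * N <= q * N.

Lemma exists_picks : 0 < B -> exists F : {set E},
  [/\ F \subset D, forall v, #|edges_at ends F v| <= 15 + (v \in U).*2
    & {in U &, forall u v, nbr u v ->
        c @: edges_at ends (D :\: F) u != c @: edges_at ends (D :\: F) v}].
Proof.
move=> B0; have [|p [picks_ok sp]] := oks_total (dom := slots) B0 picks_ok_none.
  by move=> S s Sd sd sS gS; apply: picks_step.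
have [lp _ /forallP fp] := and3P picks_ok; have FD : picked p \subset D.
  apply/subsetP=> e; rewrite inE => /existsP[s /eqP/(legalP lp)[_ /(subsetP (A_star _))]].
  by rewrite inE => /andP[].
have starF v : edges_at ends (picked p) v = picked_at p v by [].
exists (picked p); split=> [//|v|u v uU vU uv]; first by rewrite starF card_picked_at.
have out w e : e \in star w -> e \notin picked p -> e \in edges_at ends (D :\: picked p) w.
  by rewrite !inE => /andP[-> ->] ->.
have sD w : edges_at ends (D :\: picked p) w \subset star w by apply/edges_at_sub/subsetDl.
apply/eqP=> same.
(* A colour of [u] absent at [v] cannot remain, so it sits on one of the at most 17 picked edges at
   [u]. *)
have uvr : risky u v.
  rewrite /risky uU vU uv /=; apply: (@leq_trans #|c @: picked_at p u|).
    apply/subset_leq_card/subsetP=> x; rewrite in_setD => /andP[xv /imsetP[e eu xe]].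
    rewrite xe; apply: imset_f; apply: contraR xv => ep.
    have : c e \in c @: edges_at ends (D :\: picked p) u.
      by apply: imset_f; apply: out => //; apply: contraNN ep; rewrite !inE in eu *; case/andP: eu => _ -> ->.
    by rewrite same xe => /imsetP[f fv ->]; apply: imset_f; apply: subsetP fv.
  by apply: leq_trans (leq_imset_card _ _) _; have := card_picked_at u picks_ok; rewrite uU.
(* If the colour of a pick [a] remained at [v], it would also remain at [u], on an edge that
   properness identifies with [a]. *)
have /negP := implyP (forallP (fp u) v) uvr; apply; apply/forallP=> b.
have /suppP[a pa] : (u, b) \in supp p by rewrite sp inE.
rewrite pa; apply/implyP=> /imsetP[e ev ce]; apply/exists_inP; exists e; last first.
  by move: ev; rewrite ce eqxx inE => /andP[_ ->].
have [_ /(subsetP (A_star _)) /= au] := legalP lp pa.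
have ap : a \in picked p by rewrite inE; apply/existsP; exists (u, b); rewrite pa.
apply: contraLR ap => ep.
have : c a \in c @: edges_at ends (D :\: picked p) v by rewrite ce; apply/imset_f/out.
rewrite -same => /imsetP[a' a'u caa']; rewrite (cP au (subsetP (sD u) _ a'u) caa').
by move: a'u; rewrite !inE => /andP[/andP[]].
Qed.

End Picks.

Lemma disjoint_halves (T : finType) (S : {set T}) q : 2 * q <= #|S| ->
  exists A : bool -> {set T}, [/\ forall b, A b \subset S, forall b, #|A b| = q
    & forall b b' x, x \in A b -> x \in A b' -> b = b'].
Proof.
move=> qS; have [|A1 A1S A1q] := @subset_of_card _ S q; first by lia.
have [|A2 A2S A2q] := @subset_of_card _ (S :\: A1) q.
  by rewrite cardsD (setIidPr A1S); lia.
exists (fun b => if b then A1 else A2); split=> [[]|[]|] //.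
  exact: subset_trans A2S (subsetDl _ _).
have A12 x : x \in A2 -> x \notin A1 by move/(subsetP A2S); rewrite inE => /andP[].
by move=> [] [] x // H1 H2; [have := A12 _ H2; rewrite H1 | have := A12 _ H1; rewrite H2].
Qed.

(** * Numerical estimates for the picks *)

Lemma bin_le_exp n k : 'C(n, k) * k`! <= n ^ k.
Proof.
rewrite bin_ffact; elim: k n => // k IH n; rewrite ffactnS expnS leq_mul2l.
apply/orP; right; apply: leq_trans (IH _) _; case: k {IH} => // k.
by rewrite leq_exp2r // leq_pred.
Qed.

(** That is, 5.1 ^ 15 / 15! is at most 1 / 30; this makes 15 a sufficient load bound. *)
Lemma constant_15 : 30 * 51 ^ 15 <= 10 ^ 15 * 15`!.
Proof. rewrite !factS fact0. lia. Qed.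

(** With [d] at most [n / m] times [B], the quotient of ['C(d, k)] by [B ^ k] is at most
    [(n / m) ^ k] over [k!], hence at most [1 / r]. *)
Lemma cancel_binomial k r m n d B a M : 0 < n -> 0 < B -> m * d <= n * B ->
    r * n ^ k <= m ^ k * k`! -> B ^ k * a <= 'C(d, k) * M ->
  r * a <= M.
Proof.
move=> n0 B0 md rk Ba; have nB : 0 < n ^ k * B ^ k by rewrite muln_gt0 !expn_gt0 n0 B0.
rewrite -(leq_pmul2l nB).
have -> : n ^ k * B ^ k * (r * a) = r * n ^ k * (B ^ k * a).
  by rewrite mulnACA (mulnC _ r).
apply: leq_trans (leq_mul rk Ba) _.
rewrite mulnA -[_ * 'C(_, _)]mulnA (mulnC k`!) leq_mul2r -expnMn; apply/orP; right.
apply: leq_trans (leq_mul (leqnn _) (bin_le_exp d k)) _.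
by case: k {rk Ba nB} => // k; rewrite -expnMn leq_exp2r.
Qed.

(** The slack between [q] and [B] is about [B / 10]. Overloads use at most a thirtieth of [q * N]
    and flaws fewer than [7100 * N], which a [B] of 200000 absorbs. *)
Lemma picks_numeric d B N a b1 b2 : d <= 5 * B + 4 -> 200 * 1000 <= B ->
    B ^ 15 * a <= (B + B %/ 10) * ('C(d, 15) * N) ->
    B * b1 <= d * (1225 * N) ->
    B ^ 2 * b2 <= (B + B %/ 10) * (2 * (d * (2 * (36 * N)))) ->
  a + b1 + b2 + B * N <= (B + B %/ 10) * N.
Proof.
set q := B + B %/ 10 => dB B0 ha h1 h2.
have dB' : 10 * d <= 51 * B by lia.
have qB : 10 * q <= 11 * B by lia.
have qB' : 11 * B <= 10 * q + 9 by lia.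
have {}ha : 30 * a <= q * N.
  apply: (cancel_binomial (k := 15) (B := B) _ _ dB' constant_15 _) => //.
    by rewrite (leq_trans _ B0).
  by rewrite mulnCA.
have BB : 0 < B by rewrite (leq_trans _ B0).
have {}h1 : 10 * b1 <= 51 * (1225 * N).
  rewrite -(leq_pmul2l BB) mulnCA; apply: leq_trans (leq_mul (leqnn 10) h1) _.
  by rewrite mulnA [X in _ <= X]mulnA (mulnC B) leq_mul2r dB' orbT.
have {}h2 : 100 * b2 <= 11 * 51 * (144 * N).
  rewrite -(@leq_pmul2l (B ^ 2)) ?expn_gt0 ?BB // mulnCA.
  apply: leq_trans (leq_mul (leqnn 100) h2) _.
  have -> : 100 * (q * (2 * (d * (2 * (36 * N))))) = 10 * q * (10 * d) * (144 * N) by lia.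
  have -> : B ^ 2 * (11 * 51 * (144 * N)) = 11 * B * (51 * B) * (144 * N) by lia.
  by rewrite leq_mul2r leq_mul ?orbT.

nia.
Qed.

(** * Colouring the multigraph in two rounds *)

Section Multigraph.

Variables (E V : finType) (ends : E -> {set V}) (D : {set E}) (U : {set V}) (d B : nat).

Notation star := (edges_at ends).

Hypothesis D2 : loopless ends D.
Hypothesis DU : {in D, forall e, exists2 x, x \in U & x \in ends e}.
Hypothesis deg_le : forall v, #|star D v| <= d.
Hypothesis dB : d <= 5 * B + 4.
Hypothesis B_large : 200 * 1000 <= B.
Hypothesis deg_ge : {in U, forall u, 2 * (B + B %/ 10) <= #|star D u|}.
Hypothesis simpleU : {in U &, forall u v, u != v -> #|star D u :&: star D v| <= 1}.
Hypothesis double : {in U, forall u v, v \notin U -> #|star D u :&: star D v| <= 2}.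
Hypothesis deg_low : forall v, v \notin U -> #|star D v| < d.

(** The 18 colours for [F] are disjoint from the first [d.+1], so equal final palettes would force
    equal sets of old colours outside [F]. *)
Theorem distinguishing_on : exists c : E -> 'I_(d.+1 + 18),
  proper_on ends D c /\
  {in U &, forall u v, nbr ends D u v -> c @: star D u != c @: star D v}.
Proof.
have [||u v uU vu _|c cP] := @multigraph_vizing E V ends d.+1 D U _ D2 DU.
- by [].
- by move=> u _; rewrite ltnW // ltnS deg_le.
(* The multiplicity is at most 1 for high [v]; for low [v] it may be 2, offset by a degree below
   [d]. *)
- case: (boolP (v \in U)) => vU.
    by have := simpleU uU vU; rewrite eq_sym => /(_ vu); have := deg_le v; lia.
  by have := double uU vU; have := deg_low vU; lia.
pose Q u (A : bool -> {set E}) := [/\ forall b, A b \subset star D u,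
  u \in U -> forall b, #|A b| = B + B %/ 10 & forall b b' x, x \in A b -> x \in A b' -> b = b'].
have [A AP] : exists A : {ffun V -> {ffun bool -> {set E}}}, forall u, Q u (A u).
  suff /fin_all_exists[A AP] : forall u, exists A : {ffun bool -> {set E}}, Q u A.
    by exists [ffun u => A u] => u; rewrite ffunE.
  move=> u; case: (boolP (u \in U)) => uU.
    have [A [AS Aq AD]] := disjoint_halves (deg_ge uU).
    by exists (finfun A); split=> [b|_ b|b b' x]; rewrite !ffunE //; apply: AD.
  exists [ffun=> set0]; split=> [b||b b' x]; rewrite ?ffunE ?sub0set //; last by rewrite inE.
  by rewrite (negbTE uU).
have [|||N a b1 b2||F [FD Fdeg Fdist]] :=
    @exists_picks E V _ ends D U c d (B + B %/ 10) B (fun s => A s.1 s.2) D2 cP deg_le simpleU.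
- by case=> u b; have [] := AP u.
- by case=> u b /= uU; have [_ /(_ uU)] := AP u.
- by move=> u b b' e; have [_ _] := AP u; apply.
- exact: picks_numeric.
- by apply: leq_trans B_large.
have F2 : loopless ends F by move=> e /(subsetP FD)/D2.
have [||u uU|u v uU vu _|c' c'P] := @multigraph_vizing E V ends 18 F U _ F2.
- by [].
- by move=> e /(subsetP FD)/DU.
- by have := Fdeg u; rewrite uU; lia.
(* Degree plus multiplicity is at most 17 + 1 for high [v] and 15 + 2 for low [v]. *)
- have := Fdeg v; have := subset_leq_card (setISS (edges_at_sub ends u FD) (edges_at_sub ends v FD)).
  case: (boolP (v \in U)) => vU /=.
    by have := simpleU uU vU; rewrite eq_sym => /(_ vu); lia.
  by have := double uU vU; lia.
pose c2 e := if e \in F then rshift d.+1 (c' e) else lshift 18 (c e).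
have starF v e : e \in star D v -> e \in F -> e \in star F v.
  by rewrite !inE => /andP[_ ->] ->.
exists c2; split.
  move=> e f v ev fv; rewrite /c2; case: ifP => eF; case: ifP => fF.
  - by move/rshift_inj; apply: (c'P _ _ v); apply: starF.
  - by move/eqP; rewrite eq_rlshift.
  - by move/eqP; rewrite eq_lrshift.
  - by move/lshift_inj; apply: cP ev fv.
move=> u v uU vU uv; apply: contraNneq (Fdist u v uU vU uv) => same.
have sub w w' : c2 @: star D w = c2 @: star D w' ->
    c @: star (D :\: F) w \subset c @: star (D :\: F) w'.
  move=> ww'; apply/subsetP=> _ /imsetP[e ew ->].
  have : c2 e \in c2 @: star D w by apply/imset_f/(subsetP (edges_at_sub _ _ (subsetDl D F)) _ ew).
  move: ew; rewrite !inE => /andP[/andP[eF eD] we].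
  rewrite ww' /c2 (negbTE eF) => /imsetP[f]; case: ifPn => fF fw'.
    by move/eqP; rewrite eq_lrshift.
  move/lshift_inj => ->; apply: imset_f; move: fw'; rewrite !inE fF.
  by move=> /andP[-> ->].
by rewrite eqEsubset !sub.
Qed.

End Multigraph.

(** * Colouring the edges between low vertices *)

Section LowEdges.

Variables (E V C : finType) (ends : E -> {set V}) (L : {set E}) (c0 : E -> C) (t B : nat).

Notation star := (edges_at ends [set: E]).
Notation other := (other ends).
Notation partial := {ffun E -> option C}.

Hypothesis E2 : loopless ends [set: E].
Hypothesis simple : forall u v, u != v -> #|star u :&: star v| <= 1.
Hypothesis c0P : proper_on ends (~: L) c0.
Hypothesis low : forall e v, e \in L -> v \in ends e -> #|star v| <= t.

(** Edges outside [L] carry their base colour from the start; on [L], [None] means still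
    uncoloured. *)
Definition hue (p : partial) e : option C := if e \in L then p e else Some (c0 e).

(** The common edge [h] is left out because it contributes the same colour at both ends. *)
Definition pal (p : partial) v h : {set C} :=
  [set x | [exists e in star v :\ h, hue p e == Some x]].

(* The edges other than [h = uv] whose colours decide whether [u] and [v] are distinguished. *)
Definition deciding u v h : {set E} := ((star u :|: star v) :&: L) :\ h.

(** A pair is tested only once all its deciding edges are coloured. Pairs without deciding edges are
    excluded, since no choice made here separates them. *)
Definition critical u v h (p : partial) :=
  [&& u != v, h \in L, h \in star u :&: star v, deciding u v h != set0 & deciding u v h \subset supp p].

Definition low_ok (p : partial) :=
  [&& supp p \subset L,
      [forall v, forall e in star v, forall f in star v, (e != f) && (hue p e != None) ==> (hue p e != hue p f)]
    & [forall u, forall v, forall h, critical u v h p ==> (pal p u h != pal p v h)]].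

Lemma hue_restr S p e x : hue (restr S p) e = Some x -> hue p e = Some x.
Proof. by rewrite /hue; case: ifP => // _; apply: restr_sub. Qed.

Lemma low_ok_proper p v e f x : low_ok p -> e \in star v -> f \in star v ->
  hue p e = Some x -> hue p f = Some x -> e = f.
Proof.
case/and3P=> _ /forallP/(_ v)/forall_inP P _ ev fv hex hfx; apply/eqP; apply: contraTT isT => ef.
by have := implyP (forall_inP (P _ ev) _ fv); rewrite ef hex hfx eqxx => /(_ isT).
Qed.

Lemma pal_eq (p p' : partial) v h :
  {in star v :\ h, hue p =1 hue p'} -> pal p v h = pal p' v h.
Proof.
move=> pp; apply/setP=> x; rewrite !inE; apply/exists_inP/exists_inP => -[e ev ex].
  by exists e; rewrite // -pp.
by exists e; rewrite // pp.
Qed.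

Lemma deciding_in u v h e : (e \in star u) || (e \in star v) -> e \in L -> e != h -> e \in deciding u v h.
Proof. by move=> ev eL eh; rewrite in_setD1 eh in_setI in_setU ev. Qed.

Lemma low_ok_restr S p : low_ok p -> low_ok (restr S p).
Proof.
move=> okp; have /and3P[pL _ /forallP dp] := okp; apply/and3P; split.
- by apply: subset_trans pL; apply/subsetP=> e /suppP[x /restr_sub px]; apply/suppP; exists x.
- apply/forallP=> v; apply/forall_inP=> e ev; apply/forall_inP=> f fv; apply/implyP=> /andP[ef].
  case ex: (hue _ e) => [x|//] _; apply: contraNneq ef => /esym fx.
  by rewrite (low_ok_proper okp ev fv (hue_restr ex) (hue_restr fx)).
- apply/forallP=> u; apply/forallP=> v; apply/forallP=> h; apply/implyP=> /and5P[uv hL huv Q0 QS].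
  have sub : {in deciding u v h, forall e, restr S p e = p e}.
    by move=> e /(subsetP QS)/suppP[x px]; rewrite px (restr_sub px).
  have hueE w : w \in [set u; v] -> {in star w :\ h, hue (restr S p) =1 hue p}.
    move=> wuv e; rewrite in_setD1 => /andP[eh ew]; rewrite /hue; case: ifP => // eL.
    apply: sub; apply: deciding_in => //; move: wuv; rewrite in_set2.
    by case/orP=> /eqP <-; rewrite ew ?orbT.
  rewrite !(pal_eq (hueE _ _)) ?set21 ?set22 //.
  apply: (implyP (forallP (forallP (dp u) v) h)); apply/and5P; split=> //.
  apply: subset_trans QS _; apply/subsetP=> e /suppP[x /restr_sub px]; apply/suppP.
  by exists x.
Qed.

(** No pair is critical yet, since a nonempty deciding set does not fit in an empty support. *)
Lemma low_ok_none : low_ok [ffun=> None].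
Proof.
have s0 : supp ([ffun=> None] : partial) = set0 by apply/setP=> e; rewrite !inE ffunE.
apply/and3P; split; first by rewrite s0 sub0set.
- apply/forallP=> v; apply/forall_inP=> e ev; apply/forall_inP=> f fv.
  rewrite /hue !ffunE; case: ifPn => eL; rewrite ?andbF //=; case: ifPn => fL; rewrite ?andbF ?implybT //.
  rewrite andbT; apply/implyP; apply: contraNneq => -[cc]; apply/eqP; apply: (c0P (v := v)) cc.
    by move: ev; rewrite !inE eL.
  by move: fv; rewrite !inE fL.
- apply/forallP=> u; apply/forallP=> v; apply/forallP=> h; apply/implyP=> /and5P[_ _ _ Q0].
  by rewrite s0 subset0 (negbTE Q0).
Qed.

Definition free e (p : partial) : {set C} :=
  [set x | [forall v in ends e, forall f in star v, hue p f != Some x]].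

Lemma card_free e p : e \in L -> #|C| - 2 * t <= #|free e p|.
Proof.
move=> eL; rewrite leq_subLR -cardsT -(cardsID (free e p) setT) setTI addnC leq_add2r.
have sub : Some @: (setT :\: free e p) \subset hue p @: \bigcup_(v in ends e) star v.
  apply/subsetP=> _ /imsetP[x + ->]; rewrite in_setD in_setT andbT inE negb_forall_in.
  case/exists_inP=> v ve; rewrite negb_forall_in => /exists_inP[f fv]; rewrite negbK => /eqP <-.
  by apply: imset_f; apply/bigcupP; exists v.
have injS : injective (@Some C) by move=> ? ? [].
rewrite -(card_imset _ injS); apply: leq_trans (subset_leq_card sub) _.
apply: leq_trans (leq_imset_card _ _) _; rewrite -(E2 (in_setT e)) -[X in X <= _]mul1n.
by apply: leq_mul_bigcup => v ve; rewrite mul1n; apply: low ve.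
Qed.

Section Step.

Variables (S : {set E}) (e : E).
Hypotheses (SL : S \subset L) (eL : e \in L) (eS : e \notin S).
Hypothesis gS : growing low_ok B S.

Let X := extensions low_ok S e (free e).

Lemma low_supp p : p \in X -> supp p = e |: S /\ low_ok (restr S p).
Proof. by rewrite inE => /and3P[/eqP]. Qed.

Lemma low_old p f : p \in X -> f != e -> restr S p f = p f.
Proof.
move=> /low_supp[sp _] fe; rewrite ffunE; case: ifP => // fS.
have : f \notin supp p by rewrite sp in_setU1 (negbTE fe) fS.
by rewrite inE negbK => /eqP ->.
Qed.

Lemma low_hue p f : p \in X -> f != e -> hue (restr S p) f = hue p f.
Proof. by move=> pX fe; rewrite /hue low_old. Qed.

Lemma low_new p : p \in X -> exists2 x, hue p e = Some x &
  forall v f, v \in ends e -> f \in star v -> f != e -> hue p f != Some x.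
Proof.
move=> pX; have := pX; rewrite inE => /and3P[_ _]; rewrite /hue eL.
case: (p e) => // x; rewrite inE => /forall_inP xf; exists x => // v f ve fv fe.
by have := forall_inP (xf v ve) f fv; rewrite low_hue.
Qed.

Lemma low_proper p v f g x : p \in X -> f \in star v -> g \in star v ->
  hue p f = Some x -> hue p g = Some x -> f = g.
Proof.
move=> pX; have [y ey new] := low_new pX; have [_ okp] := low_supp pX.
case: (eqVneq f e) => [->|fe]; case: (eqVneq g e) => [->|ge] //.
- rewrite ey in_edges_at => ve gv [<-] gy.
  by have := new v g ve gv ge; rewrite gy eqxx.
- rewrite ey [e \in _]in_edges_at => fv ve fx [xy].
  by have := new v f ve fv fe; rewrite fx xy eqxx.
- by rewrite -(low_hue pX fe) -(low_hue pX ge) => fv gv; apply: low_ok_proper okp fv gv.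
Qed.

Definition bad_pair v h : {set partial} :=
  [set p in X | (deciding v (other v h) h \subset supp p) && (pal p v h == pal p (other v h) h)].

Definition side v : {set E} := (star v :&: L) :\ e.

Lemma star_inj v w f g : v != w -> f \in star v -> f \in star w -> g \in star v -> g \in star w -> f = g.
Proof.
move=> vw fv fw gv gw; have /card_le1_eqP := simple vw; apply; rewrite in_setI.
  by rewrite gv.
by rewrite fv.
Qed.

Lemma sideP v h : reflect [/\ h != e, h \in star v & h \in L] (h \in side v).
Proof. by rewrite /side in_setD1 in_setI; apply: and3P. Qed.

Lemma hue_off (S' : {set E}) p f : p \in X -> f != e -> f \notin S' ->
  hue (restr (S :\: S') p) f = hue p f.
Proof.
move=> pX fe fS'; rewrite -(low_hue pX fe) /hue; case: ifP => // _.
by rewrite !ffunE in_setD fS'.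
Qed.

Lemma hue_on (S' : {set E}) p f : f \in L -> f \in e |: S' -> hue (restr (S :\: S') p) f = None.
Proof.
rewrite /hue => ->; rewrite ffunE in_setU1 in_setD => /orP[/eqP->|->] //.
by rewrite (negbTE eS) andbF.
Qed.

(** By simplicity only [h] joins [v] to its far end, so forgetting edges at [v] leaves the far
    palette unchanged. *)
Lemma pal_far (S' : {set E}) v h p : p \in X -> v \in ends e -> S' \subset side v ->
  h \in side v -> pal (restr (S :\: S') p) (other v h) h = pal p (other v h) h.
Proof.
move=> pX ve /subsetP S'v /sideP[he hv hL]; apply: pal_eq => f; rewrite in_setD1 => /andP[fh fo].
have [_ nvo] := endsE E2 hv; have ho := edges_at_other E2 hv.
have fv : f \notin star v.
  by apply: contraNN fh => fv; apply/eqP; apply: star_inj nvo fo fv ho hv.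
apply: hue_off => //; first by apply: contraNneq fv => ->; rewrite in_edges_at.
by apply: contraNN fv => /S'v/sideP[].
Qed.

Definition fresh (S' : {set E}) p : {set C} :=
  [set x | [exists g in e |: S', hue p g == Some x]].

Lemma card_fresh (S' : {set E}) p : #|fresh S' p| <= #|S'|.+1.
Proof.
have injS : injective (@Some C) by move=> ? ? [].
rewrite -(card_imset _ injS); apply: (@leq_trans #|e |: S'|); last first.
  by rewrite cardsU1; case: (e \notin S').
apply: leq_trans (leq_imset_card (hue p) _); apply: subset_leq_card.
apply/subsetP=> _ /imsetP[x + ->]; rewrite inE => /exists_inP[g gS' /eqP <-].
exact: imset_f.
Qed.

(** By properness the forgotten colours occur on no other edge at [v]. *)
Lemma pal_near (S' : {set E}) v h p : p \in X -> v \in ends e -> S' \subset side v :\ h ->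
  h \in side v -> pal p v h :\: pal (restr (S :\: S') p) v h = fresh S' p.
Proof.
move=> pX ve /subsetP S'v /sideP[he hv hL].
have S'P g : g \in e |: S' -> [/\ g != h, g \in star v & g \in L].
  rewrite in_setU1 => /orP[/eqP->|/S'v]; first by rewrite eq_sym he in_edges_at ve eL.
  by rewrite in_setD1 => /andP[-> /sideP[_ -> ->]].
apply/setP=> x; rewrite in_setD; apply/andP/idP.
  rewrite !inE => -[old /exists_inP[g gv /eqP gx]]; apply/exists_inP; exists g; last by rewrite gx.
  apply: contraR old; rewrite in_setU1 negb_or => /andP[ge gS'].
  by apply/exists_inP; exists g; rewrite // hue_off // gx.
rewrite [x \in fresh _ _]inE => /exists_inP[g gS' /eqP gx]; have [gh gv gL] := S'P _ gS'.
split; last first.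
  by rewrite inE; apply/exists_inP; exists g; rewrite ?gx // in_setD1 gh gv.
apply/negP; rewrite inE => /exists_inP[f]; rewrite in_setD1 => /andP[fh fv] /eqP fx.
have fg : f = g := low_proper pX fv gv (hue_restr fx) gx.
by move: fx; rewrite fg hue_on.
Qed.

(** Equality of the two palettes lets the set of forgotten colours be recovered from the restricted
    assignment alone. *)
Lemma bad_pair_fresh (S' : {set E}) v h p : p \in bad_pair v h -> v \in ends e ->
    S' \subset side v :\ h -> h \in side v ->
  pal (restr (S :\: S') p) (other v h) h :\: pal (restr (S :\: S') p) v h = fresh S' p.
Proof.
move=> /setIdP[pX /andP[_ /eqP same]] ve S'v hv.
rewrite pal_far // -?same; first exact: pal_near.
exact: subset_trans S'v (subsetDl _ _).
Qed.

(** The forgotten colours form a known set of at most [#|S'|.+1] elements; recording the one given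
    to [e] determines the other, if any. *)
Lemma card_bad_pair (S' : {set E}) v h : v \in ends e -> h \in side v ->
    S' \subset side v :\ h -> #|S'| <= 1 ->
  B ^ #|S'| * #|bad_pair v h| <= #|S'|.+1 * #|oks low_ok S|.
Proof.
move=> ve hv S'v S'1; have /sideP[he hv' hL] := hv.
have S'P g : g \in S' -> [/\ g != e, g \in star v, g \in L & g != h].
  by move=> /(subsetP S'v); rewrite in_setD1 => /andP[-> /sideP[-> -> ->]].
have coloured p g : p \in bad_pair v h -> g \in S' -> exists x, p g = Some x.
  move=> /setIdP[_ /andP[dp _]] /S'P[_ gv gL gh]; apply/suppP; apply: (subsetP dp).
  by apply: deciding_in; rewrite ?gv.
pose Z p := pal p (other v h) h :\: pal p v h.
(* The bound on [H] must hold for every restricted assignment, so oversized candidate sets are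
   replaced by [set0]. *)
pose H (p : partial) : {set option C} := if #|Z p| <= #|S'|.+1 then Some @: Z p else set0.
have eE (p : partial) : hue p e = p e by rewrite /hue eL.
apply: (@card_flawed _ _ low_ok B low_ok_restr _ S S' e _ (fun p => p e) H) => //.
- rewrite card_gt0 => /set0Pn[p pb]; apply/subsetP=> g gS'; have [x px] := coloured _ _ pb gS'.
  have [/low_supp[sp _] _] := setIdP pb; have [ge _ _ _] := S'P _ gS'.
  by have : g \in supp p by [apply/suppP; exists x]; rewrite sp in_setU1 (negbTE ge).
- by move=> p /setIdP[/low_supp].
- move=> p pb; have [/low_new[x ex _] _] := setIdP pb.
  rewrite /H /Z (bad_pair_fresh pb ve S'v hv) card_fresh -eE ex; apply: imset_f.
  by rewrite inE; apply/exists_inP; exists e; rewrite ?setU11 ?ex.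
- move=> p p' pb p'b r epp.
  have fpp : fresh S' p = fresh S' p'.
    by rewrite -(bad_pair_fresh pb ve S'v hv) r (bad_pair_fresh p'b ve S'v hv).
  have [pX _] := setIdP pb; have [p'X _] := setIdP p'b.
  have [sp _] := low_supp pX; have [sp' _] := low_supp p'X.
  apply/ffunP=> g; case: (eqVneq g e) => [->|ge]; first exact: epp.
  case: (boolP (g \in S')) => gS'; last first.
    by rewrite -(low_old pX ge) -(low_old p'X ge); have /ffunP/(_ g) := r; rewrite !ffunE in_setD gS'.
  have [x px] := coloured _ _ pb gS'; have [_ gv gL gh] := S'P _ gS'.
  have gE (p1 : partial) : hue p1 g = p1 g by rewrite /hue gL.
  have : x \in fresh S' p'.
    by rewrite -fpp inE; apply/exists_inP; exists g; rewrite ?gE ?px // in_setU1 gS' orbT.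
  rewrite inE => /exists_inP[g']; rewrite in_setU1 => /orP[/eqP->|g'S'] /eqP.
    rewrite eE -epp -eE => ex; have eg : e = g.
      by apply: (low_proper pX (v := v) _ gv ex); rewrite ?in_edges_at // gE.
    by rewrite eg eqxx in ge.
  have /card_le1_eqP/(_ _ _ gS' g'S') -> := S'1.
  by rewrite gE px.
- by move=> p _; rewrite /H; case: ifP; rewrite ?cards0 // => ?; apply: leq_trans (leq_imset_card _ _) _.
Qed.

(** If [e] has at most one other low edge at [v], there is at most one pair, spoiled by at most one
    colour. Otherwise, for each [h], a further low edge at [v] can be forgotten, which gains a
    factor [B] at the price of 2. *)
Lemma card_bad_side v : v \in ends e ->
  B * #|\bigcup_(h in side v) bad_pair v h| <= (2 * t + B) * #|oks low_ok S|.
Proof.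
move=> ve; case: (leqP #|side v| 1) => side1.
  apply: (@leq_trans (B * (#|side v| * #|oks low_ok S|))).
    rewrite leq_mul2l -[X in X <= _]mul1n; apply/orP; right.
    apply: leq_mul_bigcup => h hv; rewrite mul1n.
    by have := @card_bad_pair set0 v h ve hv (sub0set _); rewrite cards0 !mul1n; apply.
  by rewrite mulnA leq_mul2r; apply/orP; right; case: #|side v| side1 => [|[]] //; lia.
apply: (@leq_trans (#|side v| * (2 * #|oks low_ok S|))).
  apply: leq_mul_bigcup => h hv.
  have /card_gt0P[f fv] : 0 < #|side v :\ h| by move: side1; rewrite (cardsD1 h) hv.
  have := @card_bad_pair [set f] v h ve hv; rewrite cards1 expn1; apply=> //.
  by rewrite sub1set.
rewrite mulnCA mulnA leq_mul2r; apply/orP; right.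
have : #|side v| <= t.
  apply: leq_trans (low eL ve); apply: subset_leq_card; apply: subset_trans (subsetDl _ _) (subsetIl _ _).
by lia.
Qed.

Lemma criticalC u v h p : critical u v h p = critical v u h p.
Proof. by rewrite /critical /deciding eq_sym setIC setUC. Qed.

(** A newly spoiled pair has [e] among its deciding edges: otherwise it was already critical and
    spoiled before. *)
Lemma low_cover :
  X \subset oks low_ok (e |: S) :|: \bigcup_(v in ends e) \bigcup_(h in side v) bad_pair v h.
Proof.
apply/subsetP=> p pX; have [sp okp] := low_supp pX; have [pL' _ /forallP dp'] := and3P okp.
rewrite in_setU; case: (boolP [forall u, forall v, forall h, critical u v h p ==> (pal p u h != pal p v h)]) => [dp|].
  apply/orP; left; rewrite inE sp eqxx /low_ok dp andbT /=; apply/andP; split.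
    by rewrite sp subUset sub1set eL.
  apply/forallP=> v; apply/forall_inP=> f fv; apply/forall_inP=> g gv; apply/implyP=> /andP[fg].
  case fx: (hue p f) => [x|//] _; apply: contraNneq fg => /esym gx.
  by rewrite (low_proper pX fv gv fx gx).
rewrite negb_forall => /existsP[u]; rewrite negb_forall => /existsP[v].
rewrite negb_forall => /existsP[h]; rewrite negb_imply negbK => /andP[cr same].
apply/orP; right.
have [uv hL /setIP[hu hv] Q0 Qp] := and5P cr.
have eQ : e \in deciding u v h.
  apply: contraTT isT => eQ; have QS : deciding u v h \subset S.
    apply/subsetP=> g gQ; have := subsetP Qp _ gQ; rewrite sp in_setU1.
    by case/orP=> // /eqP ge; rewrite -ge gQ in eQ.
  have := implyP (forallP (forallP (dp' u) v) h).
  have palE w : w \in [set u; v] -> pal (restr S p) w h = pal p w h.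
    move=> wuv; apply: pal_eq => f; rewrite in_setD1 => /andP[fh fw].
    case: (boolP (f \in L)) => fL; last by rewrite /hue (negbTE fL).
    apply: low_hue => //; apply: contraNneq eQ => <-; apply: deciding_in => //.
    by move: wuv; rewrite in_set2 => /orP[] /eqP <-; rewrite fw ?orbT.
  rewrite !palE ?set21 ?set22 // same; case/(_ _)/negP => //.
  apply/and5P; split=> //; first by rewrite in_setI hu.
  by rewrite supp_restr // sp subsetUr.
(* The two ends play symmetric roles; with [e] at [u], the edge [h] is another low edge at [u],
   leading to [v]. *)
wlog eu : u v uv hu hv Q0 Qp cr same eQ / e \in star u => [H|].
  have := eQ; rewrite in_setD1 in_setI in_setU => /andP[_ /andP[/orP[|] ev _]]; first exact: (H u v).
  have dC : deciding v u h = deciding u v h by rewrite /deciding setUC.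
  by apply: (H v u); rewrite ?dC // 1?criticalC // eq_sym.
have vo : v = other u h by apply: (other_uniq E2 hu hv); rewrite eq_sym.
apply/bigcupP; exists u; first by rewrite -in_edges_at.
apply/bigcupP; exists h.
  by apply/sideP; split=> //; move: eQ; rewrite in_setD1 eq_sym => /andP[].
by apply/setIdP; split=> //; rewrite -vo Qp same.
Qed.

Hypothesis numeric : B + 2 * t <= #|C| /\ 2 * (2 * t + B) <= (#|C| - 2 * t - B) * B.
Hypothesis B0 : 0 < B.

Lemma low_step : B * #|oks low_ok S| <= #|oks low_ok (e |: S)|.
Proof.
have [n1 n2] := numeric; set n := #|C| - 2 * t in n2.
have nX : n * #|oks low_ok S| <= #|X| by apply: card_extensions => // p _; apply: card_free.
have := leq_trans nX (leq_trans (subset_leq_card low_cover) (leq_card_setU _ _).1).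
set bad := \bigcup_(v in ends e) _ => hX.
have hb : B * #|bad| <= 2 * ((2 * t + B) * #|oks low_ok S|).
  apply: (@leq_trans (#|ends e| * ((2 * t + B) * #|oks low_ok S|))); last by rewrite E2.
  by apply: leq_mul_bigcup => v; apply: card_bad_side.
have {}hb : #|bad| <= (n - B) * #|oks low_ok S|.
  rewrite -(leq_pmul2l B0); apply: leq_trans hb _.
  by rewrite mulnA mulnCA mulnA leq_mul2r n2 orbT.
rewrite -(leq_add2r #|bad|); apply: leq_trans hX; apply: leq_trans (leq_add (leqnn _) hb) _.
by rewrite -mulnDl subnKC // /n; lia.
Qed.

End Step.

Hypothesis numeric : B + 2 * t <= #|C| /\ 2 * (2 * t + B) <= (#|C| - 2 * t - B) * B.
Hypothesis B0 : 0 < B.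

Theorem extend_low : exists c : E -> C,
  [/\ proper_on ends [set: E] c, {in ~: L, c =1 c0}
    & forall u v h, u != v -> h \in L -> h \in star u :&: star v -> deciding u v h != set0 ->
        c @: star u != c @: star v].
Proof.
have [S s SL sL sS gS|p [okp sp]] := oks_total (dom := L) B0 low_ok_none; first exact: low_step.
have [c cE] : exists c : E -> C, forall e, hue p e = Some (c e).
  suff /fin_all_exists[c cE] : forall e, exists x, hue p e = Some x by exists c.
  move=> e; rewrite /hue; case: ifP => eL; last by exists (c0 e).
  by apply/suppP; rewrite sp.
have cP : proper_on ends [set: E] c.
  by move=> e f v ev fv cef; apply: low_ok_proper okp ev fv (cE e) _; rewrite cE cef.
exists c; split=> // [e|u v h uv hL huv Q0].
  by rewrite inE => eL; have := cE e; rewrite /hue (negbTE eL) => -[].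
have cr : critical u v h p.
  apply/and5P; split=> //; rewrite sp; apply: subset_trans (subsetDl _ _) (subsetIr _ _).
have [_ _ /forallP/(_ u)/forallP/(_ v)/forallP/(_ h)/implyP/(_ cr)] := and3P okp.
(* By properness, [pal] is the full palette minus the colour of [h], so equal full palettes would
   give equal [pal]. *)
have palE w : h \in star w -> pal p w h = (c @: star w) :\ c h.
  move=> hw; apply/setP=> x; rewrite in_setD1 inE; apply/exists_inP/andP.
    move=> [e]; rewrite in_setD1 => /andP[eh ew]; rewrite cE => /eqP[<-]; split; last exact: imset_f.
    by apply: contraNneq eh => /(cP _ _ _ ew hw) ->.
  case=> xh /imsetP[e ew xe]; exists e; last by rewrite cE xe.
  by rewrite in_setD1 ew andbT; apply: contraNneq xh => <-; rewrite xe.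
have [hu hv] := setIP huv; rewrite !palE //; apply: contraNneq => -> //.
Qed.

End LowEdges.

(** * Merging low vertices *)

Section Assembly.

Variable G : sgraph.

Let E : finType := edge G.
Let ends : E -> {set G} := val.

Notation star := (edges_at ends [set: E]).
Notation other := (other ends).

Lemma edge_ends (f : E) : exists u v, [/\ adj u v, u != v & ends f = [set u; v]].
Proof.
have /imsetP[[u v]] := valP f; rewrite inE /= => uv fE; exists u, v; split=> //.
by apply: contraTneq uv => ->; rewrite adj_irrefl.
Qed.

Lemma ends2 : loopless ends [set: E].
Proof. by move=> f _; have [u [v [_ uv ->]]] := edge_ends f; rewrite cards2 uv. Qed.

Lemma edge_simple (u v : G) : u != v -> #|star u :&: star v| <= 1.
Proof.
move=> uv; apply/card_le1_eqP.
have fE (f : E) : f \in star u :&: star v -> ends f = [set u; v].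
  case/setIP=> fu fv; have [-> _] := endsE ends2 fu.
  by rewrite (other_uniq ends2 fu fv) // eq_sym.
by move=> f g /fE fE' /fE gE; apply: val_inj; rewrite -[val f]/(ends f) -[val g]/(ends g) fE' gE.
Qed.

Lemma adj_edge (u v : G) : adj u v -> exists2 f : E, f \in star u & f \in star v.
Proof.
move=> uv; have uvE : [set u; v] \in edges G by apply/imsetP; exists (u, v); rewrite ?inE.
by exists (exist (fun f : {set G} => f \in edges G) _ uvE : edge G); rewrite in_edges_at /ends /= ?set21 ?set22.
Qed.

Lemma other_adj (u : G) f : f \in star u -> adj u (other u f).
Proof.
move=> fu; have [fE nu] := endsE ends2 fu; have [x [y [xy _ fE']]] := edge_ends f.
have : other u f \in [set x; y] by rewrite -fE' fE set22.
have : u \in [set x; y] by rewrite -fE' fE set21.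
rewrite !in_set2 => /orP[]/eqP ux /orP[]/eqP oy; move: nu; rewrite oy ux ?eqxx //.
by rewrite adj_sym.
Qed.

Lemma card_star (u : G) : #|star u| = degree u.
Proof.
have inj : {in star u &, injective (other u)}.
  move=> f g fu gu fg; have [fE nu] := endsE ends2 fu; have [gE _] := endsE ends2 gu.
  by apply: val_inj; rewrite -[val f]/(ends f) -[val g]/(ends g) fE gE fg.
rewrite -(card_in_imset inj) /degree; congr #|pred_of_set _|; apply/setP=> v; rewrite [RHS]inE.
apply/imsetP/idP => [[f fu ->]|uv]; first exact: other_adj.
have [f fu fv] := adj_edge uv; exists f => //; apply: (other_uniq ends2 fu fv).
by apply: contraTneq uv => ->; rewrite adj_irrefl.
Qed.

Lemma degree_le (u : G) : degree u <= max_degree G.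
Proof. exact: (leq_bigmax (F := fun u : G => degree u)). Qed.

Variable q : nat.

(** The threshold leaves room for two disjoint sets of [q] candidate edges, one for each pick. *)
Definition high (u : G) := 2 * q <= degree u.

Definition lows : {set E} := [set f | [forall u in ends f, ~~ high u]].

Notation deciders := (deciding ends lows).

(* Low vertices joined by an isolated edge of the graph of low-low edges. *)
Definition mates (u v : G) :=
  (u != v) && [exists h in lows, (h \in star u :&: star v) && (deciders u v h == set0)].

(** Merged vertices are represented as sets of vertices of [G]. *)
Definition block (u : G) : {set G} := [set v | (v == u) || mates u v].

Definition block_ends (f : E) : {set {set G}} := block @: ends f.

Notation bstar := (edges_at block_ends (~: lows)).

Lemma lowsP f (u : G) : f \in lows -> f \in star u -> ~~ high u.
Proof. by rewrite in_edges_at inE => /forall_inP; apply. Qed.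

Lemma matesP (u v : G) : reflect (u != v /\ exists2 h, h \in lows &
  [/\ h \in star u, h \in star v & deciders u v h = set0]) (mates u v).
Proof.
apply: (iffP andP) => -[uv].
  by case/exists_inP=> h hL /andP[/setIP[hu hv] /eqP Q0]; split=> //; exists h.
by case=> h hL [hu hv Q0]; split=> //; apply/exists_inP; exists h; rewrite // in_setI hu hv Q0 eqxx.
Qed.

Lemma matesC (u v : G) : mates u v = mates v u.
Proof.
apply/matesP/matesP => -[uv [h hL [hu hv Q0]]]; (split; first by rewrite eq_sym); exists h => //;
  by split=> //; rewrite -Q0 /deciding setUC.
Qed.

Lemma mates_low (u v : G) : mates u v -> ~~ high u /\ ~~ high v.
Proof. by case/matesP=> _ [h hL [hu hv _]]; rewrite !(lowsP hL). Qed.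

(** A low edge to a second mate would belong to the deciding set of the first pair, which is
    empty. *)
Lemma mates_uniq (u v w : G) : mates u v -> mates u w -> v = w.
Proof.
case/matesP=> uv [h hL [hu hv Q0]] /matesP[uw [h' hL' [hu' hw _]]].
have hh : h' = h.
  have /eqP := Q0; apply: contraTeq => hh; apply/set0Pn; exists h'.
  by apply: deciding_in; rewrite ?hu'.
rewrite hh in hw; rewrite (other_uniq ends2 hu hv) 1?eq_sym //.
by rewrite [RHS](other_uniq ends2 hu hw) // eq_sym.
Qed.

Lemma block_refl (u : G) : u \in block u.
Proof. by rewrite inE eqxx. Qed.

Lemma block_high (u : G) : high u -> block u = [set u].
Proof.
move=> hu; apply/setP=> v; rewrite !inE; case: (eqVneq v u) => //= _.
by apply/negP => /mates_low[]; rewrite hu.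
Qed.

Lemma block_mates (u v : G) : mates u v -> block u = block v.
Proof.
move=> uv; apply/setP=> w; rewrite !inE; apply/orP/orP => -[/eqP->|m].
- by right; rewrite matesC.
- by left; rewrite (mates_uniq uv m).
- by right.
- by move: uv; rewrite matesC => vu; left; rewrite (mates_uniq vu m).
Qed.

Lemma block_inj (u v : G) : high u -> block u = block v -> u = v.
Proof. by move=> hu uv; have := block_refl v; rewrite -uv block_high // => /set1P. Qed.

Lemma card_block (u : G) : #|block u| <= 2.
Proof.
case: (boolP [exists v, mates u v]) => [/existsP[v uv]|/existsPn none].
  apply: (@leq_trans #|[set u; v]|); last by rewrite cards2; case: eqP.
  apply/subset_leq_card/subsetP=> w; rewrite !inE => /orP[->//|m].
  by rewrite (mates_uniq uv m) eqxx orbT.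
apply: (@leq_trans #|[set u]|); last by rewrite cards1.
by apply/subset_leq_card/subsetP=> w; rewrite !inE => /orP[//|m]; have := none w; rewrite m.
Qed.

Lemma block_low (u v : G) : ~~ high u -> v \in block u -> ~~ high v.
Proof. by move=> lu; rewrite inE => /orP[/eqP->//|/mates_low[]]. Qed.

Lemma bstarE w f : (f \in bstar w) = (f \notin lows) && (w \in block_ends f).
Proof. by rewrite inE in_setC. Qed.

Lemma star_high (u : G) f : high u -> f \in star u -> f \notin lows.
Proof. by move=> hu fu; apply: contraL hu => fL; apply: lowsP fL fu. Qed.

Lemma bstar_high (u : G) : high u -> bstar (block u) = star u.
Proof.
move=> hu; apply/setP=> f; rewrite bstarE; apply/andP/idP => [[fL /imsetP[x xf]]|fu].
  by move/(block_inj hu) => ->; rewrite in_edges_at.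
by split; [apply: star_high fu | apply: imset_f; rewrite -in_edges_at].
Qed.

Lemma bstar_sub w : bstar w \subset \bigcup_(x in w) star x.
Proof.
apply/subsetP=> f; rewrite bstarE => /andP[_ /imsetP[x xf ->]].
by apply/bigcupP; exists x; rewrite ?block_refl ?in_edges_at.
Qed.

Lemma star_bstar (u : G) f : f \notin lows -> f \in star u -> f \in bstar (block u).
Proof. by move=> fL fu; rewrite bstarE fL; apply: imset_f; rewrite -in_edges_at. Qed.

Lemma bstar_low w : bstar w != set0 -> w \notin [set block u | u in G & high u] ->
  exists2 u, w = block u & ~~ high u.
Proof.
case/set0Pn=> f; rewrite bstarE => /andP[_ /imsetP[u _ ->]] uU; exists u => //.
by apply: contra uU => hu; apply: imset_f; rewrite inE.
Qed.

(** An edge outside [lows] has a high end, and the block of a high vertex is a singleton. *)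
Lemma block_ends2 : loopless block_ends (~: lows).
Proof.
move=> f; rewrite in_setC inE negb_forall_in => /exists_inP[u uf]; rewrite negbK => hu.
have fu : f \in star u by rewrite in_edges_at.
have [fE nu] := endsE ends2 fu.
rewrite /block_ends fE imsetU1 imset_set1 cards2; case: eqP => // /(block_inj hu) uo.
by rewrite -uo eqxx in nu.
Qed.

Hypothesis q_def : q = max_degree G %/ 5 + max_degree G %/ 5 %/ 10.
Hypothesis large : 1000 * 1000 <= max_degree G.

Let d := max_degree G.
Let U : {set {set G}} := [set block u | u in G & high u].

Lemma UP w : reflect (exists2 u, high u & w = block u) (w \in U).
Proof.
apply: (iffP imsetP) => [[u]|[u hu ->]]; first by rewrite inE => hu ->; exists u.
by exists u; rewrite // inE.
Qed.

(** A low block has at most two vertices of degree below [2 * q], and [4 * q] is about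
    [0.88 * d]. *)
Lemma bstar_lt w : w \notin U -> #|bstar w| < d.
Proof.
move=> wU; have [->|w0] := eqVneq (bstar w) set0; first by rewrite cards0 /d; move: large; lia.
have [u wE lu] := bstar_low w0 wU.
apply: (@leq_ltn_trans (#|w| * (2 * q))).
  apply: leq_trans (subset_leq_card (bstar_sub w)) _; rewrite -[X in X <= _]mul1n.
  apply: leq_mul_bigcup => x; rewrite wE mul1n card_star => /(block_low lu).
  by rewrite /high -ltnNge => /ltnW.
apply: (@leq_ltn_trans (2 * (2 * q))); first by rewrite leq_mul2r wE card_block orbT.
by rewrite /d; move: large q_def; lia.
Qed.

Lemma base_colouring : exists c : E -> 'I_(d.+1 + 18),
  proper_on block_ends (~: lows) c /\
  {in U &, forall u v, nbr block_ends (~: lows) u v -> c @: bstar u != c @: bstar v}.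
Proof.
apply: (@distinguishing_on _ _ block_ends (~: lows) U d (d %/ 5)).
- exact: block_ends2.
- move=> f; rewrite in_setC inE negb_forall_in => /exists_inP[u uf]; rewrite negbK => hu.
  by exists (block u); [apply/UP; exists u | apply: imset_f].
- move=> w; case: (boolP (w \in U)) => [/UP[u hu ->]|/bstar_lt/ltnW//].
  by rewrite bstar_high // card_star degree_le.
- by lia.
- by rewrite /d; move: large; lia.
- by move=> _ /UP[u hu ->]; rewrite bstar_high // card_star /d -q_def.
- move=> _ _ /UP[u hu ->] /UP[v hv ->] uv; rewrite !bstar_high //; apply: edge_simple.
  by apply: contraNneq uv => ->.
(* Parallel edges from a high vertex end in distinct vertices of one block, of which there are at
   most two. *)
- move=> _ /UP[u hu ->] w wU; have [->|w0] := eqVneq (bstar w) set0; first by rewrite setI0 cards0.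
  have [v wE lv] := bstar_low w0 wU; apply: leq_trans (card_block v); rewrite -wE -[#|w|]muln1.
  apply: (@leq_trans #|\bigcup_(x in w) (star u :&: star x)|).
    apply/subset_leq_card/subsetP=> f /setIP[fu /(subsetP (bstar_sub w))/bigcupP[x xw fx]].
    by apply/bigcupP; exists x => //; rewrite in_setI fx -(bstar_high hu) fu.
  rewrite -[X in X <= _]mul1n; apply: leq_mul_bigcup => x xw; rewrite mul1n.
  apply: edge_simple; apply: contraTneq hu => ->.
  by rewrite wE in xw; apply: block_low lv xw.
- exact: bstar_lt.
Qed.

Hypothesis no_isolated : forall u v : G, ~~ isolated_edge u v.

(** High pairs are separated by the base colouring and low pairs with deciding edges by
    [extend_low]. Merged pairs are separated because their other edges meet at one block, where the
    base colouring is proper. *)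
Lemma full_colouring : exists c : E -> 'I_(d.+1 + 18), proper_on ends [set: E] c /\
  forall u v, adj u v -> c @: star u != c @: star v.
Proof.
have [c0 [c0P c0U]] := base_colouring.
have sub (f : E) (v : G) : f \in edges_at ends (~: lows) v -> f \in bstar (block v).
  rewrite inE => /andP[fL vf]; apply: star_bstar; last by rewrite in_edges_at.
  by rewrite -in_setC.
have [||||c [cP cc0 cL]] := @extend_low E G _ ends lows c0 (2 * q) (d %/ 10) ends2 edge_simple.
- by move=> e f v /sub ev /sub fv; apply: c0P ev fv.
- move=> e v eL; rewrite -in_edges_at card_star => /(lowsP eL).
  by rewrite /high -ltnNge => /ltnW.
- rewrite card_ord /d; move: large q_def; set D := max_degree G => lD qD.
  split; first by lia.
  (* About [0.02 * D] colours are to spare, so it suffices to bound the factor [D / 10] below by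
     200. *)
  apply: (@leq_trans ((D.+1 + 18 - 2 * (2 * q) - D %/ 10) * 200)); first by lia.
  by rewrite leq_mul2l; apply/orP; right; lia.
- by rewrite /d; move: large; lia.
exists c; split=> // u v uv; have [h hu hv] := adj_edge uv.
have nuv : u != v by apply: contraTneq uv => ->; rewrite adj_irrefl.
apply/eqP => same.
(* Equal palettes force equal degrees, so both ends are high or both are low. *)
have deg_eq : degree u = degree v.
  rewrite -!card_star -(card_in_imset (f := c) (D := mem (star u))); last first.
    by move=> e f eu fu; apply: cP eu fu.
  rewrite same card_in_imset //; by move=> e f eu fu; apply: cP eu fu.
have hiE w : high w -> c @: star w = c0 @: bstar (block w).
  move=> hw; rewrite bstar_high //; apply: eq_in_imset => f fw; apply: cc0.
  by rewrite in_setC (star_high hw).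
case: (boolP (high u)) => hiu.
  have hiv : high v by rewrite /high -deg_eq.
  have uU : block u \in U by apply/UP; exists u.
  have vU : block v \in U by apply/UP; exists v.
  have nb : nbr block_ends (~: lows) (block u) (block v).
    rewrite /nbr !bstar_high //; apply/andP; split.
      by apply: contraNneq nuv => /(block_inj hiu) ->.
    by apply/set0Pn; exists h; rewrite in_setI hu.
  by have := c0U _ _ uU vU nb; rewrite -!hiE // same eqxx.
have hiv : ~~ high v by rewrite /high -deg_eq.
have hL : h \in lows.
  rewrite inE (endsE ends2 hu).1 -(other_uniq ends2 hu hv) 1?eq_sym //.
  by apply/forall_inP=> w /set2P[->|->].
case: (eqVneq (deciders u v h) set0) => [Q0|Q0]; last first.
  by have := cL u v h nuv hL _ Q0; rewrite in_setI hu hv same eqxx => /(_ isT).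
have muv : mates u v by apply/matesP; split=> //; exists h.
(* As [uv] is not isolated and the degrees agree, [u] has an edge besides [h]; its colour must recur
   at [v]. *)
have d1 : degree u != 1.
  by have := no_isolated u v; rewrite /isolated_edge uv -deg_eq andbb.
have [g gu gh] : exists2 g, g \in star u & g != h.
  have : 0 < #|star u :\ h|.
    by move: d1; rewrite -card_star (cardsD1 h) hu; case: #|_|.
  by case/card_gt0P=> g /setD1P[gh gu]; exists g.
have [g' gv' cgg] : exists2 g', g' \in star v & c g = c g'.
  by have : c g \in c @: star v by [rewrite -same imset_f]; case/imsetP=> g' ? ?; exists g'.
have gh' : g' != h.
  by apply: contraNneq gh => gh'; apply/eqP; apply: cP gu hu _; rewrite cgg gh'.
have notL w f : f \in star w -> w \in [set u; v] -> f != h -> f \notin lows.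
  move=> fw wuv fh; apply/negP => fL; have : f \in deciders u v h.
    by apply: deciding_in => //; move: wuv; rewrite in_set2 => /orP[] /eqP <-; rewrite fw ?orbT.
  by rewrite Q0 inE.
have gL := notL _ _ gu (set21 _ _) gh; have gL' := notL _ _ gv' (set22 _ _) gh'.
(* Both edges lie at the common block of [u] and [v], so equal colours make them one edge, parallel
   to [h]. *)
have gg : g = g'.
  apply: (c0P _ _ (block u)); first exact: star_bstar.
    by rewrite (block_mates muv); apply: star_bstar.
  by rewrite -!cc0 ?in_setC.
have gv : g \in star v by rewrite gg.
by rewrite (star_inj edge_simple nuv gu gv hu hv) eqxx in gh.
Qed.

End Assembly.

(** * Conclusion with natural numbers as colours *)

Lemma card_imfset_ord (n : nat) (E : finType) (c : E -> 'I_n) :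
  #|` [fset val (c f) | f : E]%fset| <= n.
Proof.
have sub : ([fset val (c f) | f : E] `<=` [fset val i | i : 'I_n])%fset.
  by apply/fsubsetP=> x /imfsetP[f _ ->]; apply: in_imfset.
apply: leq_trans (fsubset_leq_card sub) _.
by rewrite card_imfset /=; [rewrite -cardE card_ord | apply: val_inj].
Qed.

Theorem theorem1 :
  exists Delta0 : nat, forall G : sgraph,
    Delta0 <= max_degree G ->
    (forall u v : G, ~~ isolated_edge u v) ->
    exists c : colouring G,
      adjacent_vertex_distinguishing c /\ nb_colours c <= max_degree G + 19.
Proof.
(* This makes [B], a fifth of the maximum degree, at least 200000, as [picks_numeric] demands. *)
exists (1000 * 1000) => G large no_isolated.
have [c [cP cD]] := full_colouring erefl large no_isolated.
exists (fun f => val (c f)); split; last first.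
  by apply: leq_trans (card_imfset_ord c) _; rewrite addSnnS.
split=> [f g u fg fu gu|u v /cD].
  by apply: contraNneq fg => /val_inj cfg; apply/eqP; apply: cP cfg; rewrite in_edges_at; [apply: fu | apply: gu].
apply: contraNneq => same; apply/eqP/setP=> x.
have palE w : (x \in c @: edges_at (val : edge G -> {set G}) [set: edge G] w) = (val x \in palette (fun f => val (c f)) w).
  apply/imsetP/imfsetP => -[f fw xf]; exists f.
  - by rewrite in_edges_at in fw.
  - by rewrite xf.
  - by rewrite in_edges_at.
  - exact: val_inj.
by rewrite !palE same.
Qed.
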